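(* Let $n$ be a positive integer and let $\delta,\gamma$ satisfy Conditions 1 and 2 respectively. Let $C_n(\delta,\gamma;m;u_0,\dots,u_{n-1};v_0,\dots,v_{n-1})$ be the number of partitions of $m$ in $\mathcal{C}_n(\delta,\gamma)$ in whose colours, for each $i\in\{0,\dots,n-1\}$, the symbol $a_i$ appears $u_i$ times and the symbol $b_i$ appears $v_i$ times, and let $F_n(m;u;v)$ be the number of $n^2$-coloured Frobenius partitions of weight $m$ with $u_i$ parts of the top row coloured $a_i$ and $v_i$ parts of the bottom row coloured $b_i$ for each $i$. Then $$\sum_{m,u_i,v_i\ge0}C_n(\delta,\gamma;m;u;v)\,q^m\prod_{i=0}^{n-1}a_i^{u_i-v_i}=(q;q)_\infty\sum_{m,u_i,v_i\ge0}F_n(m;u;v)\,q^m\prod_{i=0}^{n-1}a_i^{u_i-v_i}=(q;q)_\infty\,[x^0]\prod_{i=0}^{n-1}(-xa_iq;q)_\infty(-x^{-1}a_i^{-1};q)_\infty.$$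
   Context: $(a;q)_\infty=\prod_{j\ge0}(1-aq^j)$; $[x^0]$ is the coefficient of $x^0$. Colours are symbols $a_ib_k$ with $0\le i,k\le n-1$ (containing symbol $a_i$ once and $b_k$ once); $a_ib_i$ is free, $a_ib_k$ ($i\ne k$) bound. With $\chi(P)\in\{0,1\}$ the truth value of $P$, $\Delta(a_ib_k,a_{i'}b_{k'})=\chi(i\ge i')-\chi(i=k=i')+\chi(k\le k')-\chi(k=i'=k')$. $\mathcal{P}_n$ is the set of coloured partitions $\lambda_1+\dots+\lambda_s$ (positive integer parts, colours $c(\lambda_j)$) with $\lambda_j-\lambda_{j+1}\ge\Delta(c(\lambda_j),c(\lambda_{j+1}))$. Write $p_c$ for a part $p$ of colour $c$; $\lambda$ contains the pattern $\pi_1+\dots+\pi_r$ if $\lambda_i=\pi_1,\dots,\lambda_{i+r-1}=\pi_r$ (as coloured parts) for some $i$. Condition 1: $\delta$ is integer-valued on bound colours with $\min\{k,\ell\}<\delta(a_kb_\ell)\le\max\{k,\ell\}$. Condition 2: $\gamma$ is integer-valued on pairs of bound colours such that (i) if $\max\{k_1,\ell_2\}<\min\{k_2,\ell_1\}$ then $\max\{k_1,\ell_2\}<\gamma(a_{k_1}b_{\ell_1},a_{k_2}b_{\ell_2})\le\min\{k_2,\ell_1\}$; (ii) if $k_1>\ell_1$, $k_2>\ell_2$ and $\{\ell_2+1,\dots,k_2\}\setminus\{\ell_1+1,\dots,k_1\}\ne\emptyset$, then $\gamma(a_{k_1}b_{\ell_1},a_{k_2}b_{\ell_2})$ lies in this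 set; (iii) if $k_1<\ell_1$, $k_2<\ell_2$ and $\{k_1+1,\dots,\ell_1\}\setminus\{k_2+1,\dots,\ell_2\}\ne\emptyset$, then $\gamma(a_{k_1}b_{\ell_1},a_{k_2}b_{\ell_2})$ lies in this set. $\mathcal{C}_n(\delta,\gamma)$ is the set of $\lambda\in\mathcal{P}_n$ with no part coloured $a_0b_0$ avoiding, for every positive integer $p$: (a) $p_{a_ib_i}+p_{a_ib_i}$, $1\le i\le n-1$; (b) $p_{a_{k_1}b_{\ell_1}}+p_{a_ib_i}+p_{a_{k_2}b_{\ell_2}}$ when $\max\{k_1,\ell_2\}<\min\{k_2,\ell_1\}$, $i=\gamma(a_{k_1}b_{\ell_1},a_{k_2}b_{\ell_2})$; (c) for $k_2>\ell_2$: (c1) $(p+u)_{a_{k_1}b_{\ell_1}}+p_{a_ib_i}+p_{a_{k_2}b_{\ell_2}}$ for any $2\le u\le\infty$, any $k_1,\ell_1$, $i=\delta(a_{k_2}b_{\ell_2})$ ($u=\infty$ meaning $p_{a_ib_i}+p_{a_{k_2}b_{\ell_2}}$ begins the partition); (c2) $(p+1)_{a_{k_1}b_{\ell_1}}+p_{a_ib_i}+p_{a_{k_2}b_{\ell_2}}$ for $k_1\le\ell_1$, $i=\delta(a_{k_2}b_{\ell_2})$; (c3) the same pattern for $k_1>\ell_1$ with $\{\ell_2+1,\dots,k_2\}\setminus\{\ell_1+1,\dots,k_1\}\ne\emptyset$, $i=\gamma(a_{k_1}b_{\ell_1},a_{k_2}b_{\ell_2})$; (d) for $k_1<\ell_1$: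 (d1) $p_{a_{k_1}b_{\ell_1}}+p_{a_ib_i}+(p-u)_{a_{k_2}b_{\ell_2}}$ for any $2\le u\le\infty$, any $k_2,\ell_2$, $i=\delta(a_{k_1}b_{\ell_1})$ ($u=\infty$ meaning $p_{a_{k_1}b_{\ell_1}}+p_{a_ib_i}$ ends the partition); (d2) $(p+1)_{a_{k_1}b_{\ell_1}}+(p+1)_{a_ib_i}+p_{a_{k_2}b_{\ell_2}}$ for $k_2\ge\ell_2$, $i=\delta(a_{k_1}b_{\ell_1})$; (d3) the same pattern for $k_2<\ell_2$ with $\{k_1+1,\dots,\ell_1\}\setminus\{k_2+1,\dots,\ell_2\}\ne\emptyset$, $i=\gamma(a_{k_1}b_{\ell_1},a_{k_2}b_{\ell_2})$. An $n^2$-coloured Frobenius partition is an array $\begin{pmatrix}\lambda_1&\cdots&\lambda_s\\ \mu_1&\cdots&\mu_s\end{pmatrix}$ with $\lambda_1>\dots>\lambda_s$ non-negative integers coloured by symbols $a_i$, strictly decreasing for the order $0_{a_{n-1}}<\dots<0_{a_0}<1_{a_{n-1}}<\dots<1_{a_0}<\cdots$, and $\mu_1>\dots>\mu_s$ non-negative integers coloured by symbols $b_i$, strictly decreasing for $0_{b_0}<\dots<0_{b_{n-1}}<1_{b_0}<\cdots$; its weight is $s+\sum\lambda_j+\sum\mu_j$. *)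

(* Defs.v *)
From HB Require Import structures.
From mathcomp Require Import all_boot all_order all_algebra.
From mathcomp Require Import finmap.
From mathcomp.multinomials Require Import monalg.

Set Implicit Arguments.
Unset Strict Implicit.
Unset Printing Implicit Defensive.

Import Order.TTheory GRing.Theory Num.Theory.

Local Open Scope ring_scope.

(* [laurent G R] is the group ring R[G] of an additive group G of exponents:
   the finitely supported maps G -> R with the convolution product.  Hence
   [laurent int R] is R[x, x^-1], and [laurent {ffun 'I_n -> int} R] is the
   ring of Laurent polynomials in n variables.  The ring structure that
   multinomials puts on {malg R[K]} is not available here: it requires the
   monomials K to have no invertible element but 1. *)
Definition laurent (G : zmodType) (R : comNzRingType) : Type := {malg R[G]}.

HB.instance Definition _ (G : zmodType) (R : comNzRingType) :=
  GRing.Zmodule.on (laurent G R).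

Section LaurentRing.
Variables (G : zmodType) (R : comNzRingType).
Implicit Types (f g h : laurent G R) (e : G) (c : R).

Definition lterm c e : laurent G R := mkmalgU e c.
Definition lmonom e : laurent G R := lterm 1 e.
Definition lcoef e f : R := mcoeff e f.

Definition lmul f g : laurent G R :=
  \sum_(d <- msupp f) \sum_(e <- msupp g)
    lterm (mcoeff d f * mcoeff e g) (d + e).

Lemma lterm0 e : lterm 0 e = 0.
Proof. exact: monalgU0. Qed.

Lemma ltermD c c' e : lterm (c + c') e = lterm c e + lterm c' e.
Proof. exact: monalgUD. Qed.

Lemma laurentE f : f = \sum_(e <- msupp f) lterm (mcoeff e f) e.
Proof. exact: monalgE. Qed.

Lemma lmulw (s t : {fset G}) f g :
    fsubset (msupp f) s -> fsubset (msupp g) t ->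
  lmul f g =
    \sum_(d <- s) \sum_(e <- t) lterm (mcoeff d f * mcoeff e g) (d + e).
Proof.
move=> fs gt; rewrite /lmul (big_fset_incl _ fs) /=; last first.
  move=> d _ /mcoeff_outdom fd; rewrite big1 // => e _.
  by rewrite fd mul0r lterm0.
apply: eq_bigr => d _; apply: big_fset_incl => // e _ /mcoeff_outdom ->.
by rewrite mulr0 lterm0.
Qed.

Lemma lmulC : commutative lmul.
Proof.
move=> f g; rewrite /lmul exchange_big /=.
by apply: eq_bigr => e _; apply: eq_bigr => d _; rewrite mulrC addrC.
Qed.

Lemma lmulDl : left_distributive lmul +%R.
Proof.
move=> f g h; have hh := fsubset_refl (msupp h).
rewrite (lmulw (msuppD_le f g) hh) (lmulw (fsubsetUl _ (msupp g)) hh).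
rewrite (lmulw (fsubsetUr (msupp f) _) hh) -big_split /=.
apply: eq_bigr => d _; rewrite -big_split /=; apply: eq_bigr => e _.
by rewrite mcoeffD mulrDl ltermD.
Qed.

Lemma lmulDr : right_distributive lmul +%R.
Proof. by move=> f g h; rewrite lmulC lmulDl !(lmulC _ f). Qed.

Lemma lmul0 : left_zero 0 lmul.
Proof. by move=> f; rewrite /lmul msupp0 big_seq_fset0. Qed.

Lemma lmulr0 : right_zero 0 lmul.
Proof. by move=> f; rewrite lmulC lmul0. Qed.

Lemma lmul_term c c' d e :
  lmul (lterm c d) (lterm c' e) = lterm (c * c') (d + e).
Proof.
by rewrite (lmulw msuppU_le msuppU_le) !big_seq_fset1 !mcoeffUU.
Qed.

Lemma lmul_suml (I : Type) (s : seq I) (F : I -> laurent G R) g :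
  lmul (\sum_(i <- s) F i) g = \sum_(i <- s) lmul (F i) g.
Proof. exact: (big_morph (lmul^~ g) (fun _ _ => lmulDl _ _ _) (lmul0 g)). Qed.

Lemma lmul_sumr (I : Type) (s : seq I) (F : I -> laurent G R) g :
  lmul g (\sum_(i <- s) F i) = \sum_(i <- s) lmul g (F i).
Proof. by rewrite lmulC lmul_suml; apply: eq_bigr => i _; rewrite lmulC. Qed.

Lemma lmulA : associative lmul.
Proof.
move=> f g h; rewrite (laurentE f) !lmul_suml; apply: eq_bigr => d _.
rewrite (laurentE g) lmul_suml !lmul_sumr lmul_suml; apply: eq_bigr => e _.
rewrite (laurentE h) !lmul_sumr; apply: eq_bigr => k _.
by rewrite !lmul_term mulrA addrA.
Qed.

Lemma lmul1 : left_id (lmonom 0) lmul.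
Proof.
move=> f; rewrite {1}(laurentE f) lmul_sumr [RHS]laurentE.
by apply: eq_bigr => e _; rewrite lmul_term mul1r add0r.
Qed.

Lemma lone_neq0 : lmonom 0 != 0.
Proof. by rewrite monalgU_eq0 oner_eq0. Qed.

HB.instance Definition _ := GRing.Zmodule_isComNzRing.Build (laurent G R)
  lmulA lmulC lmul1 lmulDl lone_neq0.

End LaurentRing.

Arguments lmonom {G R} e.
Arguments lcoef {G R} e f.

(* A series is the function giving the coefficient of each q^m; two series are
   compared by [=1]. *)
Definition series (A : nzRingType) := nat -> A.

Section Series.
Variable A : nzRingType.

Definition sone : series A := fun m => (m == 0%N)%:R.

Definition smul (f g : series A) : series A :=
  fun m => \sum_(i < m.+1) f i * g (m - i)%N.

(* (a; q)_oo = \prod_(j >= 0) (1 - a q^j), for a polynomial in q = 'X.  The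
   factors with j > m are 1 modulo q^(m+1), so the coefficient of q^m is that
   of every partial product having at least m + 1 factors (qpochE). *)
Definition qpoch_part (a : {poly A}) (N : nat) : {poly A} :=
  \prod_(j < N) (1 - a * 'X^j).

Definition qpoch (a : {poly A}) : series A := fun m => (qpoch_part a m.+1)`_m.

Lemma qpochE (a : {poly A}) (m N : nat) :
  (m < N)%N -> (qpoch_part a N)`_m = qpoch a m.
Proof.
elim: N => // N IHN; rewrite ltnS leq_eqVlt => /predU1P[-> //|mN].
rewrite -IHN // /qpoch_part big_ord_recr /= mulrBr mulr1 coefB.
by rewrite mulrA coefMXn mN subr0.
Qed.

End Series.

Definition ct (A : comNzRingType) (f : series (laurent int A)) : series A :=
  fun m => lcoef 0 (f m).

(* Z[a_0^{+-1}, ..., a_{n-1}^{+-1}] *)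
Definition ringA (n : nat) : comNzRingType := laurent {ffun 'I_n -> int} int.

(* a_i^k *)
Definition apow (n : nat) (i : 'I_n) (k : int) : ringA n :=
  lmonom [ffun j => if j == i then k else 0].

Definition ringAx (n : nat) : comNzRingType := laurent int (ringA n).

(* a_i^k x^l *)
Definition axpow (n : nat) (i : 'I_n) (k l : int) : ringAx n :=
  lterm (apow i k) l.

(* (i, k) is the colour a_i b_k *)
Definition colour (n : nat) : finType := ('I_n * 'I_n)%type.

(* (p, c) is the part p of colour c *)
Definition cpart (n : nat) : eqType := (nat * colour n)%type.

Definition cpart_of_ord (n m : nat) (x : 'I_m.+1 * colour n) : cpart n :=
  (nat_of_ord x.1, x.2).

Definition is_free (n : nat) (c : colour n) : bool := c.1 == c.2.
Definition is_bound (n : nat) (c : colour n) : bool := c.1 != c.2.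

Definition Delta (n : nat) (c c' : colour n) : int :=
  (c'.1 <= c.1)%N%:Z - ((c.1 == c.2) && (c.2 == c'.1))%:Z
  + (c.2 <= c'.2)%N%:Z - ((c.2 == c'.1) && (c'.1 == c'.2))%:Z.

Definition inP (n : nat) (s : seq (cpart n)) : bool :=
  all (fun x => 0 < x.1)%N s &&
  sorted (fun x y => Delta x.2 y.2 <= x.1%:Z - y.1%:Z) s.

(* {l + 1, ..., k} *)
Definition ioc (n : nat) (l k : 'I_n) : {set 'I_n} := [set j : 'I_n | (l < j <= k)%N].

(* The values of delta and gamma outside bound colours are never used. *)
Definition condition1 (n : nat) (delta : colour n -> int) : Prop :=
  forall c : colour n, is_bound c ->
    (minn c.1 c.2)%:Z < delta c <= (maxn c.1 c.2)%:Z.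

Definition cross (n : nat) (c1 c2 : colour n) : bool :=
  (maxn c1.1 c2.2 < minn c2.1 c1.2)%N.

Definition condition2 (n : nat) (gamma : colour n -> colour n -> int) : Prop :=
  forall c1 c2 : colour n, is_bound c1 -> is_bound c2 ->
  [/\ cross c1 c2 ->
        (maxn c1.1 c2.2)%:Z < gamma c1 c2 <= (minn c2.1 c1.2)%:Z,
      (c1.2 < c1.1)%N -> (c2.2 < c2.1)%N ->
        ioc c2.2 c2.1 :\: ioc c1.2 c1.1 != set0 ->
        exists2 j : 'I_n,
          j \in ioc c2.2 c2.1 :\: ioc c1.2 c1.1 & gamma c1 c2 = j%:Z
    & (c1.1 < c1.2)%N -> (c2.1 < c2.2)%N ->
        ioc c1.1 c1.2 :\: ioc c2.1 c2.2 != set0 ->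
        exists2 j : 'I_n,
          j \in ioc c1.1 c1.2 :\: ioc c2.1 c2.2 & gamma c1 c2 = j%:Z].

Section ForbiddenPatterns.
Variables (n : nat) (delta : colour n -> int)
  (gamma : colour n -> colour n -> int).
Implicit Types (x y z : cpart n) (s : seq (cpart n)).

Definition has_pattern2 (P : cpart n -> cpart n -> bool) s : bool :=
  has (fun t => P t.1 t.2) (zip s (behead s)).

Definition has_pattern3 (P : cpart n -> cpart n -> cpart n -> bool) s : bool :=
  has (fun t => P t.1 t.2.1 t.2.2)
    (zip s (zip (behead s) (behead (behead s)))).

Definition free_at (k : int) (c : colour n) : bool :=
  is_free c && ((c.1 : nat)%:Z == k).

(* The predicates pat_* hold when the consecutive parts x, y, z form a forbidden
   pattern; the value p of the pattern is read off the parts.  For instance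
   pat_c1 is (p + u)_(a_k1 b_l1) + p_(a_i b_i) + p_(a_k2 b_l2) for some finite
   u >= 2, k2 > l2 and i = delta(a_k2 b_l2); pat_c1_oo is the case of an
   infinite u, where p_(a_i b_i) + p_(a_k2 b_l2) begins the partition, and
   pat_d1_oo that where p_(a_k1 b_l1) + p_(a_i b_i) ends it. *)
Definition pat_a x y : bool := [&& is_free x.2, (0 < x.2.1)%N & x == y].

Definition pat_b x y z : bool :=
  [&& x.1 == y.1, y.1 == z.1, cross x.2 z.2 & free_at (gamma x.2 z.2) y.2].

Definition tail_c y z : bool :=
  [&& (z.2.2 < z.2.1)%N, y.1 == z.1 & free_at (delta z.2) y.2].

Definition pat_c1 x y z : bool := tail_c y z && (y.1 + 2 <= x.1)%N.

Definition pat_c1_oo s : bool := if s is y :: z :: _ then tail_c y z else false.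

Definition pat_c2 x y z : bool :=
  [&& tail_c y z, x.1 == y.1.+1 & (x.2.1 <= x.2.2)%N].

Definition pat_c3 x y z : bool :=
  [&& (z.2.2 < z.2.1)%N, y.1 == z.1, x.1 == y.1.+1, (x.2.2 < x.2.1)%N,
      ioc z.2.2 z.2.1 :\: ioc x.2.2 x.2.1 != set0 &
      free_at (gamma x.2 z.2) y.2].

Definition head_d x y : bool :=
  [&& (x.2.1 < x.2.2)%N, x.1 == y.1 & free_at (delta x.2) y.2].

Definition pat_d1 x y z : bool := head_d x y && (z.1 + 2 <= y.1)%N.

Definition pat_d1_oo s : bool :=
  if rev s is y :: x :: _ then head_d x y else false.

Definition pat_d2 x y z : bool :=
  [&& head_d x y, y.1 == z.1.+1 & (z.2.2 <= z.2.1)%N].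

Definition pat_d3 x y z : bool :=
  [&& (x.2.1 < x.2.2)%N, x.1 == y.1, y.1 == z.1.+1, (z.2.1 < z.2.2)%N,
      ioc x.2.1 x.2.2 :\: ioc z.2.1 z.2.2 != set0 &
      free_at (gamma x.2 z.2) y.2].

Definition inC s : bool :=
  [&& inP s, ~~ has (fun x => free_at 0 x.2) s,
      ~~ has_pattern2 pat_a s, ~~ has_pattern3 pat_b s,
      ~~ has_pattern3 pat_c1 s, ~~ pat_c1_oo s,
      ~~ has_pattern3 pat_c2 s, ~~ has_pattern3 pat_c3 s,
      ~~ has_pattern3 pat_d1 s, ~~ pat_d1_oo s,
      ~~ has_pattern3 pat_d2 s & ~~ has_pattern3 pat_d3 s].

Definition weightP s : nat := \sum_(x <- s) x.1.

Definition C_spec (m : nat) (u v : 'I_n -> nat) s : bool :=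
  [&& inC s, weightP s == m,
      [forall i, count (fun x => x.2.1 == i) s == u i] &
      [forall i, count (fun x => x.2.2 == i) s == v i]].

(* The count ranges over the sequences of at most m parts, each at most m:
   C_spec_bounded shows that no partition is lost. *)
Definition C_num (m : nat) (u v : 'I_n -> nat) : nat :=
  #|[set t : m.-bseq ('I_m.+1 * colour n)
      | C_spec m u v (map (@cpart_of_ord n m) t)]|.

End ForbiddenPatterns.

Lemma size_le_sum (T : Type) (f : T -> nat) (s : seq T) :
  all (fun x => 0 < f x)%N s -> (size s <= \sum_(x <- s) f x)%N.
Proof.
elim: s => [|x s IHs] /=; first by rewrite big_nil.
by case/andP=> fx /IHs; rewrite big_cons -add1n; apply: leq_add.
Qed.

Lemma le_sum_seq (T : eqType) (f : T -> nat) (s : seq T) (x : T) :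
  x \in s -> (f x <= \sum_(y <- s) f y)%N.
Proof. by move=> xs; rewrite (big_rem x) //= leq_addr. Qed.

Lemma C_spec_bounded (n : nat) (delta : colour n -> int)
    (gamma : colour n -> colour n -> int) (m : nat) (u v : 'I_n -> nat)
    (s : seq (cpart n)) :
  C_spec delta gamma m u v s ->
  [/\ (size s <= m)%N, all (fun x => x.1 <= m)%N s,
      (forall i, u i <= m)%N & (forall i, v i <= m)%N].
Proof.
case/and4P=> /andP[/andP[s_gt0 _] _] /eqP sm /forallP uE /forallP vE.
have size_s : (size s <= m)%N by rewrite -sm size_le_sum.
split=> // [|i|i].
- by apply/allP => x xs; rewrite -sm (le_sum_seq (fun x => x.1)).
- by rewrite -(eqP (uE i)) (leq_trans (count_size _ _)).
by rewrite -(eqP (vE i)) (leq_trans (count_size _ _)).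
Qed.

(* The array is the sequence of its columns.  The integer p coloured by a_i
   (top) or b_i (bottom) is (p, i). *)
Definition fcolumn (n : nat) : eqType := ((nat * 'I_n) * (nat * 'I_n))%type.

Definition fcolumn_of_ord (n m : nat)
    (x : ('I_m.+1 * 'I_n) * ('I_m.+1 * 'I_n)) : fcolumn n :=
  ((nat_of_ord x.1.1, x.1.2), (nat_of_ord x.2.1, x.2.2)).

Definition top_lt (n : nat) (x y : nat * 'I_n) : bool :=
  (x.1 < y.1)%N || (x.1 == y.1) && (y.2 < x.2)%N.

Definition bot_lt (n : nat) (x y : nat * 'I_n) : bool :=
  (x.1 < y.1)%N || (x.1 == y.1) && (x.2 < y.2)%N.

Definition frobenius (n : nat) (s : seq (fcolumn n)) : bool :=
  sorted (fun x y => top_lt y x) (unzip1 s) &&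
  sorted (fun x y => bot_lt y x) (unzip2 s).

Definition weightF (n : nat) (s : seq (fcolumn n)) : nat :=
  size s + \sum_(x <- unzip1 s) x.1 + \sum_(x <- unzip2 s) x.1.

Definition F_spec (n m : nat) (u v : 'I_n -> nat) (s : seq (fcolumn n)) : bool :=
  [&& frobenius s, weightF s == m,
      [forall i, count (fun x => x.2 == i) (unzip1 s) == u i] &
      [forall i, count (fun x => x.2 == i) (unzip2 s) == v i]].

(* As for C_num: at most m columns with entries at most m (F_spec_bounded). *)
Definition F_num (n m : nat) (u v : 'I_n -> nat) : nat :=
  #|[set t : m.-bseq (('I_m.+1 * 'I_n) * ('I_m.+1 * 'I_n))
      | F_spec m u v (map (@fcolumn_of_ord n m) t)]|.

Lemma F_spec_bounded (n m : nat) (u v : 'I_n -> nat) (s : seq (fcolumn n)) :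
  F_spec m u v s ->
  [/\ (size s <= m)%N, all (fun x => (x.1.1 <= m) && (x.2.1 <= m))%N s,
      (forall i, u i <= m)%N & (forall i, v i <= m)%N].
Proof.
case/and4P=> _ /eqP sm /forallP uE /forallP vE.
have size_s : (size s <= m)%N by rewrite -sm /weightF -addnA leq_addr.
split=> // [|i|i].
- apply/allP => x xs; rewrite -sm /weightF; apply/andP; split.
    apply: leq_trans (leq_addr _ _); apply: leq_trans (leq_addl _ _).
    by apply: (le_sum_seq (fun y => y.1)); apply: map_f.
  apply: leq_trans (leq_addl _ _).
  by apply: (le_sum_seq (fun y => y.1)); apply: map_f.
- by rewrite -(eqP (uE i)) (leq_trans (count_size _ _)) // size_map.
by rewrite -(eqP (vE i)) (leq_trans (count_size _ _)) // size_map.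
Qed.

(* \sum_(m, u, v) N m u v q^m \prod_i a_i^(u_i - v_i), for counting functions N
   with N m u v = 0 unless all the u_i and v_i are at most m; this holds for
   C_num and F_num by C_spec_bounded and F_spec_bounded. *)
Definition genfun (n : nat) (N : nat -> ('I_n -> nat) -> ('I_n -> nat) -> nat) :
    series (ringA n) :=
  fun m => \sum_(u : {ffun 'I_n -> 'I_m.+1}) \sum_(v : {ffun 'I_n -> 'I_m.+1})
    (N m (fun i => u i) (fun i => v i))%:R *
    \prod_(i < n) apow i ((u i)%:Z - (v i)%:Z).

(* Main.v *)
Require Import Defs.
From mathcomp Require Import all_boot all_order all_algebra.
From mathcomp Require Import zify ring.
From mathcomp.multinomials Require Import monalg.

(* Write P for the generating function of P_n, in which a_i b_k has weight
   a_i / a_k, so that free colours have weight 1.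

   (q; q)_oo P is the generating function of C_n(delta, gamma).  Once the bound
   parts are fixed, all the free parts of a given size p lie in a single slot,
   where they share one colour.  The forbidden patterns exclude repetitions and
   exactly one of the colours that fit the slot (a_0 b_0 when there is no bound
   part of size p); hence inserting one more part p in the slot, of the excluded
   colour if the slot is empty, is an injection of P_n into itself, and C_n is
   what remains when the images for all p are removed.

   P is computed with a transfer matrix.  Padding by parts 0 of colour a_0 b_0,
   P is the limit of the generating functions of the sequences of s + 1 parts
   that end in this part.  Multiplied by (q)_s, the generating function of the
   sequences of s + 1 parts ending in 0 of colour c satisfies
   E_(s+1)(c') = wt(c') \sum_c q^(s Delta(c, c')) E_s(c), and E_(s+1) has a closed
   form in terms of \sum_r kap s r * U_r(f) * V_r(g), where U_r(f) / (q)_r is the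
   coefficient of z^r in \prod_(i < f) (-z a_i)_oo \prod_(i >= f) (-z q a_i)_oo and
   V_r is its analogue for the b_k.  At c = a_0 b_0 this tends to
   \sum_r q^r e_r e'_r, with e_r and e'_r the elementary symmetric functions of
   the a_i q^j and of the b_k q^j: this is both the constant term of the product
   and the generating function of the Frobenius partitions with r columns,
   summed over r. *)

Set Implicit Arguments.
Unset Strict Implicit.
Unset Printing Implicit Defensive.

Import Order.TTheory GRing.Theory Num.Theory.

Local Open Scope ring_scope.

Lemma eq_lincomb (K : pzRingType) (c l r x y : K) :
  l = r -> x - y = c * (l - r) -> x = y.
Proof. by move=> ->; rewrite subrr mulr0 => /eqP; rewrite subr_eq0 => /eqP. Qed.

(** * Gaussian binomials *)

Section QBinomial.
Variables (K : comNzRingType) (q : K).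

Fixpoint qbin (s r : nat) : K :=
  match r, s with
  | 0, _ => 1
  | _.+1, 0 => 0
  | r'.+1, s'.+1 => qbin s' r' + q ^+ r * qbin s' r
  end.

Definition qfact (s : nat) : K := \prod_(j < s) (1 - q ^+ j.+1).

Lemma qfactS s : qfact s.+1 = qfact s * (1 - q ^+ s.+1).
Proof. by rewrite /qfact big_ord_recr. Qed.

Lemma qbin0 s : qbin s 0 = 1.
Proof. by case: s. Qed.

Lemma qbinS s r : qbin s.+1 r.+1 = qbin s r + q ^+ r.+1 * qbin s r.+1.
Proof. by []. Qed.

Lemma qbin_small s r : (s < r)%N -> qbin s r = 0.
Proof.
elim: s r => [|s IHs] [|r] //= sr.
by rewrite !IHs // ?mulr0 ?addr0 // ltnW.
Qed.

Lemma qbin_next s r : (r <= s)%N ->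
  (1 - q ^+ r.+1) * qbin s r.+1 = (1 - q ^+ (s - r)) * qbin s r.
Proof.
elim: s r => [|s IHs] [|r] // rs.
- by rewrite /= subrr mulr0 mul0r.
- move: (IHs 0%N isT); rewrite qbinS !qbin0 !subn0 => h.
  by rewrite [q ^+ s.+1]exprS; apply: (eq_lincomb (c := q) h); ring.
have diag : (1 - q ^+ r.+2) * qbin s.+1 r.+2 = (1 - q ^+ s.+1) * qbin s r.+1.
  rewrite qbinS; case: (ltnP r s) => [lt_rs|le_sr].
    have -> : q ^+ s.+1 = q ^+ r.+2 * q ^+ (s - r.+1).
      by rewrite -exprD; congr (_ ^+ _); lia.
    by apply: (eq_lincomb (c := q ^+ r.+2) (IHs _ lt_rs)); ring.
  by rewrite !(@qbin_small s) //; [ring | lia].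
rewrite diag qbinS subSS.
have -> : q ^+ s.+1 = q ^+ r.+1 * q ^+ (s - r).
  by rewrite -exprD; congr (_ ^+ _); lia.
by apply: (eq_lincomb (c := 1) (IHs r rs)); ring.
Qed.

Lemma qbin_diag s r :
  (1 - q ^+ r.+1) * qbin s.+1 r.+1 = (1 - q ^+ s.+1) * qbin s r.
Proof.
rewrite qbinS; case: (leqP r s) => [rs|sr].
  have -> : q ^+ s.+1 = q ^+ r.+1 * q ^+ (s - r).
    by rewrite -exprD; congr (_ ^+ _); lia.
  by apply: (eq_lincomb (c := q ^+ r.+1) (qbin_next rs)); ring.
by rewrite !(@qbin_small s) //; [ring | lia].
Qed.

Lemma qbin_up s r : (r <= s.+1)%N ->
  (1 - q ^+ (s.+1 - r)) * qbin s.+1 r = (1 - q ^+ s.+1) * qbin s r.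
Proof. by move=> rs; rewrite -qbin_next // qbin_diag. Qed.

Lemma qbin_fact s r : (r <= s)%N ->
  qbin s r * qfact r = \prod_(j < r) (1 - q ^+ (s - j)).
Proof.
elim: r s => [|r IHr] s rs; first by rewrite /qfact !big_ord0 qbin0 mulr1.
case: s rs => // s rs; rewrite big_ord_recl subn0.
rewrite -[X in _ = _ * X]/(\prod_(j < r) (1 - q ^+ (s - j))) -(IHr s rs).
by rewrite qfactS; apply: (eq_lincomb (c := qfact r) (qbin_diag s r)); ring.
Qed.

(* [kap s r] is [qbin s r * (q)_s / (q)_r], without division. *)
Definition kap (s r : nat) : K := qbin s r * \prod_(r <= j < s) (1 - q ^+ j.+1).

Lemma kap_small s r : (s < r)%N -> kap s r = 0.
Proof. by move=> sr; rewrite /kap qbin_small // mul0r. Qed.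

Lemma kap_diag s r :
  (1 - q ^+ r.+1) ^+ 2 * kap s.+1 r.+1 = (1 - q ^+ s.+1) ^+ 2 * kap s r.
Proof.
case: (leqP r s) => [rs|sr]; last by rewrite !kap_small ?mulr0.
have e : (1 - q ^+ r.+1) * \prod_(r.+1 <= j < s.+1) (1 - q ^+ j.+1) =
    (1 - q ^+ s.+1) * \prod_(r <= j < s) (1 - q ^+ j.+1).
  by rewrite -(big_ltn (F := fun j => 1 - q ^+ j.+1)) // big_nat_recr //= mulrC.
rewrite /kap; move: (qbin_diag s r) e.
set x := qbin _ _; set y := qbin _ _; set z := \prod_(_ <= _ < _) _.
set t := \prod_(_ <= _ < _) _ => h1 h2.
transitivity (((1 - q ^+ r.+1) * x) * ((1 - q ^+ r.+1) * z)); first by ring.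
by rewrite h1 h2; ring.
Qed.

Lemma kap_up s r : (r <= s.+1)%N ->
  q ^+ (s.+1 - r) * kap s.+1 r = kap s.+1 r - (1 - q ^+ s.+1) ^+ 2 * kap s r.
Proof.
rewrite leq_eqVlt => /predU1P[->|rs].
  by rewrite subnn expr0 mul1r (@kap_small s) // mulr0 subr0.
have e : \prod_(r <= j < s.+1) (1 - q ^+ j.+1) =
    \prod_(r <= j < s) (1 - q ^+ j.+1) * (1 - q ^+ s.+1) by rewrite big_nat_recr.
rewrite /kap e; set p := \prod_(r <= j < s) _.
by apply: (eq_lincomb (c := - (1 - q ^+ s.+1) * p) (qbin_up (ltnW rs))); ring.
Qed.

Lemma kap_fact s r : (r <= s)%N ->
  kap s r * qfact r ^+ 2 = qfact s * \prod_(j < r) (1 - q ^+ (s - j)).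
Proof.
move=> rs; rewrite -qbin_fact // /kap.
have -> : qfact s = qfact r * \prod_(r <= j < s) (1 - q ^+ j.+1).
  by rewrite /qfact -!(big_mkord xpredT (fun j => 1 - q ^+ j.+1)) -big_cat_nat.
by ring.
Qed.

End QBinomial.

(** * The transfer matrix *)

Section Grid.
Variables (K : comNzRingType) (Q : K) (n : nat).

Lemma shift_sum_r (x : nat -> K) f : (f < n)%N ->
  \sum_(i < n) Q ^+ (f.+1 <= i)%N * x i - \sum_(i < n) Q ^+ (f <= i)%N * x i =
  (1 - Q) * x f.
Proof.
move=> fn; rewrite -sumrB (bigD1 (Ordinal fn)) //= ltnn leqnn big1 ?addr0.
  by ring.
move=> i; rewrite -val_eqE /= => ne_if.
by rewrite (_ : (f < i)%N = (f <= i)%N) ?subrr //; lia.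
Qed.

Lemma shift_sum_l (x : nat -> K) g : (g < n)%N ->
  \sum_(i < n) Q ^+ (i < g)%N * x i - \sum_(i < n) Q ^+ (i < g.+1)%N * x i =
  (1 - Q) * x g.
Proof.
move=> gn; rewrite -sumrB (bigD1 (Ordinal gn)) //= ltnn leqnn big1 ?addr0.
  by ring.
move=> i; rewrite -val_eqE /= => ne_ig.
by rewrite (_ : (i < g.+1)%N = (i < g)%N) ?subrr //; lia.
Qed.

(* Quasi-periodic in [f] and [g] with multiplier [Q], which together with its
   second differences determines it. *)
Definition quasi_sum (x : nat -> nat -> K) (f g : nat) : K :=
  \sum_(i < n) Q ^+ (f <= i)%N * \sum_(k < n) Q ^+ (k < g)%N * x i k.

Lemma quasi_sum_diff x f g : (f < n)%N -> (g < n)%N ->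
  quasi_sum x f.+1 g - quasi_sum x f g
  - (quasi_sum x f.+1 g.+1 - quasi_sum x f g.+1) = (1 - Q) ^+ 2 * x f g.
Proof.
move=> fn gn; rewrite /quasi_sum.
rewrite (shift_sum_r (fun i => \sum_(k < n) Q ^+ (k < g)%N * x i k)) //.
rewrite (shift_sum_r (fun i => \sum_(k < n) Q ^+ (k < g.+1)%N * x i k)) //.
by rewrite -mulrBr shift_sum_l // mulrA -expr2.
Qed.

Lemma quasi_sum_row x g : quasi_sum x 0 g = Q * quasi_sum x n g.
Proof.
rewrite mulr_sumr; apply: eq_bigr => i _.
by rewrite leq0n leqNgt ltn_ord expr0 mul1r expr1.
Qed.

Lemma quasi_sum_col x f : quasi_sum x f n = Q * quasi_sum x f 0.
Proof.
rewrite mulr_sumr; apply: eq_bigr => i _.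
rewrite mulrCA; congr (_ * _); rewrite mulr_sumr; apply: eq_bigr => k _.
by rewrite ltn_ord expr0 mul1r expr1.
Qed.

Hypothesis Qreg : forall x : K, (1 - Q) * x = 0 -> x = 0.

Lemma grid_eq0 (X : nat -> nat -> K) :
    (forall f g, (f < n)%N -> (g < n)%N ->
       X f.+1 g - X f g - (X f.+1 g.+1 - X f g.+1) = 0) ->
    (forall g, (g <= n)%N -> X 0%N g = Q * X n g) ->
    (forall f, (f <= n)%N -> X f n = Q * X f 0%N) ->
  forall f g, (f <= n)%N -> (g <= n)%N -> X f g = 0.
Proof.
move=> hd hr hc.
have h1 f g : (f < n)%N -> (g <= n)%N -> X f.+1 g - X f g = X f.+1 0%N - X f 0%N.
  move=> fn; elim: g => // g IHg gn; rewrite -IHg; last exact: ltnW.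
  by apply/esym/eqP; rewrite -subr_eq0 hd.
have h2 f g : (f <= n)%N -> (g <= n)%N -> X f g = X 0%N g + (X f 0%N - X 0%N 0%N).
  elim: f => [|f IHf] fn gn; first by rewrite subrr addr0.
  by apply: (eq_lincomb (c := 1) (h1 f g fn gn)); rewrite (IHf (ltnW fn) gn); ring.
have h3 g : (g <= n)%N -> X 0%N g = X 0%N 0%N.
  move=> gn; apply/eqP; rewrite -subr_eq0; apply/eqP/Qreg.
  have e1 := hr g gn; have e2 := hr 0%N (leq0n n).
  rewrite (h2 n g) // in e1.
  transitivity (X 0%N g - Q * (X 0%N g + (X n 0%N - X 0%N 0%N))
                - (X 0%N 0%N - Q * X n 0%N)); first by ring.
  by rewrite -e1 -e2 !subrr.
move=> f g fn gn; rewrite h2 // h3 // addrC subrK.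
apply: Qreg; rewrite mulrBl mul1r -hc // (h2 f n) // h3 //.
by ring.
Qed.

Lemma quasi_sum_unique x (Z : nat -> nat -> K) :
    (forall f g, (f < n)%N -> (g < n)%N ->
       Z f.+1 g - Z f g - (Z f.+1 g.+1 - Z f g.+1) = (1 - Q) ^+ 2 * x f g) ->
    (forall g, (g <= n)%N -> Z 0%N g = Q * Z n g) ->
    (forall f, (f <= n)%N -> Z f n = Q * Z f 0%N) ->
  forall f g, (f <= n)%N -> (g <= n)%N -> quasi_sum x f g = Z f g.
Proof.
move=> hd hr hc f g fn gn; apply/eqP; rewrite -subr_eq0; apply/eqP.
apply: (grid_eq0 (X := fun f g => quasi_sum x f g - Z f g)) => //.
- move=> {}f {}g {}fn {}gn; apply: (eq_lincomb (c := 1) (quasi_sum_diff x fn gn)).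
  by rewrite -hd //; ring.
- by move=> {}g {}gn; rewrite hr // quasi_sum_row -mulrBr.
- by move=> {}f {}fn; rewrite hc // quasi_sum_col -mulrBr.
Qed.

End Grid.

(* [Delta] on indices in nat; both truncated differences are exact. *)
Definition ndelta (i k i' k' : nat) : nat :=
  ((i' <= i) - ((i == k) && (k == i')) + ((k <= k') - ((k == i') && (i' == k'))))%N.

Lemma ndelta_bound k l k' l' : k != l -> k' != l' ->
  ndelta k l k' l' = ((k' <= k) + (l <= l'))%N.
Proof.
by move=> kl kl'; rewrite /ndelta (negPf kl) (negPf kl') andbF !subn0.
Qed.

Lemma ndelta_freer k l i : k != l -> ndelta k l i i = ((i <= k) + (l < i))%N.
Proof.
move=> kl; rewrite /ndelta (negPf kl) eqxx andbT subn0.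
by congr addn; case: ltngtP.
Qed.

Lemma ndelta_freel k l i : k != l -> ndelta i i k l = ((k < i) + (i <= l))%N.
Proof.
move=> kl; rewrite /ndelta (negPf kl) andbF subn0 eqxx /=.
by congr addn; case: ltngtP.
Qed.

Lemma ndelta_free i j : ndelta i i j j = (i != j).
Proof. by rewrite /ndelta !eqxx /= andbT; case: ltngtP. Qed.

Lemma ndelta_triangle k l i k' l' :
  (ndelta k l k' l' <= ndelta k l i i + ndelta i i k' l')%N.
Proof.
case: (eqVneq k l) => [<-|kl]; case: (eqVneq k' l') => [<-|kl'].
- by rewrite !ndelta_free; lia.
- by rewrite !(ndelta_freel _ kl') ndelta_free; lia.
- by rewrite !(ndelta_freer _ kl) ndelta_free; lia.
by rewrite (ndelta_freer _ kl) (ndelta_freel _ kl') ndelta_bound //; lia.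
Qed.

Section Transfer.
Variables (K : comNzRingType) (q : K) (n : nat) (a b : nat -> K).
Variables (U V : nat -> nat -> K).
Hypothesis qreg : forall s (x : K), (1 - q ^+ s.+1) * x = 0 -> x = 0.
Hypothesis abK : forall i, (i < n)%N -> a i * b i = 1.
Hypothesis U0 : forall f, U 0 f = 1.
Hypothesis V0 : forall g, V 0 g = 1.
Hypothesis US : forall r f, (f < n)%N ->
  U r.+1 f.+1 = U r.+1 f + (1 - q ^+ r.+1) * a f * U r f.
Hypothesis VS : forall r g, (g < n)%N ->
  V r.+1 g = V r.+1 g.+1 + (1 - q ^+ r.+1) * b g * V r g.+1.
Hypothesis Uper : forall r, U r 0 = q ^+ r * U r n.
Hypothesis Vper : forall r, V r n = q ^+ r * V r 0.

(* [transfer s] is E_(s+1). *)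
Fixpoint transfer (s i k : nat) : K :=
  if s is s'.+1 then
    a i * b k * \sum_(j < n) \sum_(l < n)
      q ^+ (s * ndelta j l i k) * transfer s' j l
  else a i * b k.

Definition pairing (s f g : nat) : K := \sum_(r < s.+1) kap q s r * (U r f * V r g).

Definition twisted (s f g : nat) : K :=
  pairing s f g - (1 - q ^+ s) ^+ 2 * pairing s.-1 f g.

Lemma pairing_diff s f g : (f < n)%N -> (g < n)%N ->
  pairing s.+1 f.+1 g - pairing s.+1 f g
    - (pairing s.+1 f.+1 g.+1 - pairing s.+1 f g.+1)
  = (1 - q ^+ s.+1) ^+ 2 * (a f * b g * pairing s f g.+1).
Proof.
move=> fn gn; rewrite /pairing -!sumrB big_ord_recl /= !U0 !V0 !subrr add0r.
rewrite mulrCA !mulr_sumr; apply: eq_bigr => r _.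
rewrite US // VS //.
by apply: (eq_lincomb (c := a f * b g * U r f * V r g.+1) (kap_diag q s r)); ring.
Qed.

Lemma twistedE s f g :
  twisted s.+1 f g = \sum_(r < s.+2) q ^+ (s.+1 - r) * kap q s.+1 r * (U r f * V r g).
Proof.
have -> : twisted s.+1 f g = \sum_(r < s.+2) kap q s.+1 r * (U r f * V r g)
   - (1 - q ^+ s.+1) ^+ 2 * \sum_(r < s.+2) kap q s r * (U r f * V r g).
  by rewrite [X in _ = _ - _ * X]big_ord_recr /= (@kap_small _ _ s) // mul0r addr0.
rewrite mulr_sumr -sumrB; apply: eq_bigr => r _.
rewrite kap_up; [by ring|by rewrite -ltnS].
Qed.

Lemma twisted_row s g : twisted s.+1 0 g = q ^+ s.+1 * pairing s.+1 n g.
Proof.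
rewrite twistedE mulr_sumr; apply: eq_bigr => r _.
rewrite Uper -[in q ^+ s.+1](subnK (ltnSE (ltn_ord r))) exprD.
by ring.
Qed.

Lemma twisted_col s f : twisted s.+1 f n = q ^+ s.+1 * pairing s.+1 f 0.
Proof.
rewrite twistedE mulr_sumr; apply: eq_bigr => r _.
rewrite Vper -[in q ^+ s.+1](subnK (ltnSE (ltn_ord r))) exprD.
by ring.
Qed.

Lemma pairing_corner s : pairing s 0 0 = pairing s n n.
Proof. by apply: eq_bigr => r _; rewrite Uper Vper; ring. Qed.

Lemma pairing0 f g : pairing 0 f g = 1.
Proof. by rewrite /pairing big_ord1 U0 V0 /kap big_geq // !mulr1. Qed.

Lemma twisted_diff s f g : (f < n)%N -> (g < n)%N ->
  twisted s.+1 f.+1 g - twisted s.+1 f g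
    - (twisted s.+1 f.+1 g.+1 - twisted s.+1 f g.+1)
  = (1 - q ^+ s.+1) ^+ 2 * (a f * b g * twisted s f g.+1).
Proof.
move=> fn gn; rewrite /twisted /=.
case: s => [|s] /=.
  apply: (eq_lincomb (c := 1) (pairing_diff 0 fn gn)).
  by rewrite !pairing0; ring.
apply: (eq_lincomb (c := 1) (pairing_diff s.+1 fn gn)).
rewrite -[RHS]addr0 -[X in _ = _ + X](mulr0 (- (1 - q ^+ s.+2) ^+ 2)).
rewrite -[X in _ = _ + _ * X](
  subrr ((1 - q ^+ s.+1) ^+ 2 * (a f * b g * pairing s f g.+1))).
by rewrite -{1}(pairing_diff s fn gn); ring.
Qed.

Definition transfer_form (s i k : nat) : K :=
  if i == k then pairing s i i
  else a i * b k * (if (k < i)%N then pairing s i k.+1 else twisted s i k.+1).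

Definition quasi_form (s f g : nat) : K :=
  if (g <= f)%N then pairing s.+1 f g - (1 - q ^+ s.+1) * pairing s f f
  else twisted s.+1 f g - q ^+ s.+1 * (1 - q ^+ s.+1) * pairing s f f.

Lemma quasi_form_ge s f g : (g <= f)%N ->
  quasi_form s f g = pairing s.+1 f g - (1 - q ^+ s.+1) * pairing s f f.
Proof. by rewrite /quasi_form => ->. Qed.

Lemma quasi_form_le s f g : (f <= g)%N ->
  quasi_form s f g =
    twisted s.+1 f g - q ^+ s.+1 * (1 - q ^+ s.+1) * pairing s f f.
Proof.
rewrite leq_eqVlt => /predU1P[->|fg].
  by rewrite quasi_form_ge // /twisted /=; ring.
by rewrite /quasi_form leqNgt fg.
Qed.

Lemma quasi_formE s f g : (f <= n)%N -> (g <= n)%N ->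
  quasi_sum (q ^+ s.+1) n (transfer_form s) f g = quasi_form s f g.
Proof.
apply: quasi_sum_unique; first exact: qreg.
- move=> {}f {}g fn gn; rewrite /transfer_form.
  case: (ltngtP f g) => [fg|gf|<-].
  + rewrite !quasi_form_le; try by lia.
    by apply: (eq_lincomb (c := 1) (twisted_diff s fn gn)); ring.
  + rewrite !quasi_form_ge; try by lia.
    by apply: (eq_lincomb (c := 1) (pairing_diff s fn gn)); ring.
  + rewrite (quasi_form_le _ (leqnSn f)) !quasi_form_ge // /twisted /=.
    have h := pairing_diff s fn fn; rewrite abK // mul1r in h.
    by apply: (eq_lincomb (c := 1) h); ring.
- move=> {}g gn; rewrite quasi_form_le // quasi_form_ge // twisted_row.
  by rewrite pairing_corner; ring.
- move=> {}f fn; rewrite quasi_form_le // quasi_form_ge // twisted_col.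
  by ring.
Qed.

Lemma ndelta_sum s (x : nat -> nat -> K) i k : (i < n)%N -> (k < n)%N ->
  \sum_(j < n) \sum_(l < n) q ^+ (s * ndelta j l i k) * x j l =
  if i == k then quasi_sum (q ^+ s) n x i i + (1 - q ^+ s) * x i i
  else quasi_sum (q ^+ s) n x i k.+1
       + q ^+ (s * (i <= k)%N) * (1 - q ^+ s) * x i i.
Proof.
move=> ni nk; rewrite /quasi_sum; set oi := Ordinal ni.
under [X in _ = if _ then X + _ else _]eq_bigr do rewrite mulr_sumr.
under [X in _ = if _ then _ else X + _]eq_bigr do rewrite mulr_sumr.
rewrite !(pair_big xpredT xpredT) /=.
rewrite (bigD1 (oi, oi)) //= [X in if _ then X + _ else _](bigD1 (oi, oi)) //=.
rewrite [X in if _ then _ else X + _](bigD1 (oi, oi)) //=.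
have e (P : nat -> nat -> K) : (forall j l : nat, (j, l) != (i, i) ->
    q ^+ (s * ndelta j l i k) * x j l = P j l) ->
   \sum_(p | p != (oi, oi)) q ^+ (s * ndelta p.1 p.2 i k) * x p.1 p.2 =
   \sum_(p | p != (oi, oi)) P p.1 p.2.
  by move=> h; apply: eq_bigr => -[j l] /= ne; apply: h.
case: eqP => [ik|/eqP ik].
  rewrite (e (fun j l => (q ^+ s) ^+ (i <= j)%N * ((q ^+ s) ^+ (l < i)%N * x j l))).
    rewrite /ndelta -ik !eqxx leqnn ltnn /= muln0 expr0; ring.
  move=> j l ne; rewrite mulrA -!exprM -exprD -mulnDr; congr (q ^+ (s * _) * _).
  by move: ne; rewrite /ndelta -ik xpair_eqE eqxx; lia.
rewrite (e (fun j l => (q ^+ s) ^+ (i <= j)%N * ((q ^+ s) ^+ (l < k.+1)%N * x j l))).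
  rewrite /ndelta !eqxx (negPf ik) leqnn /= subn0 add0n ltnS -exprM.
  by case: (i <= k)%N; rewrite ?muln1 ?muln0; ring.
move=> j l ne; rewrite mulrA -!exprM -exprD -mulnDr; congr (q ^+ (s * _) * _).
by move: ne ik; rewrite /ndelta ltnS xpair_eqE; lia.
Qed.

Lemma transferE s i k : (i < n)%N -> (k < n)%N ->
  transfer s i k = transfer_form s i k.
Proof.
elim: s i k => [|s IHs] i k ni nk.
  rewrite /transfer_form /twisted /= !pairing0 subrr expr0n mul0r subr0.
  by case: eqP => [<-|_]; [rewrite abK | case: ifP; rewrite mulr1].
have -> : transfer s.+1 i k = a i * b k * \sum_(j < n) \sum_(l < n)
    q ^+ (s.+1 * ndelta j l i k) * transfer_form s j l.
  rewrite /=; congr (_ * _); apply: eq_bigr => j _; apply: eq_bigr => l _.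
  by rewrite IHs.
rewrite ndelta_sum // !quasi_formE //; try exact: ltnW.
rewrite [in RHS]/transfer_form; case: eqP => [<-|/eqP ik].
  by rewrite abK // quasi_form_ge // /transfer_form eqxx; ring.
congr (_ * _); rewrite /transfer_form eqxx; case: (ltngtP i k) ik => // [ik|ki] _.
  rewrite quasi_form_le; last exact: leqW (ltnW ik).
  by rewrite /= muln1; ring.
by rewrite quasi_form_ge //= muln0 expr0; ring.
Qed.

End Transfer.

(** * Elementary symmetric functions modulo a power of q *)

Section Truncation.
Variable A : comNzRingType.
Implicit Types p t : {poly A}.

Definition eqX (M : nat) p t := forall i, (i < M)%N -> p`_i = t`_i.

Lemma eqX_refl M p : eqX M p p. Proof. by []. Qed.

Lemma eqX_sym M p t : eqX M p t -> eqX M t p.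
Proof. by move=> h i iM; rewrite h. Qed.

Lemma eqX_trans M p t u : eqX M p t -> eqX M t u -> eqX M p u.
Proof. by move=> h1 h2 i iM; rewrite h1 // h2. Qed.

Lemma eqX_sub M p p' t t' : eqX M p p' -> eqX M t t' -> eqX M (p - t) (p' - t').
Proof. by move=> h1 h2 i iM; rewrite !coefB h1 // h2. Qed.

Lemma eqX_mul M p p' t t' : eqX M p p' -> eqX M t t' -> eqX M (p * t) (p' * t').
Proof.
move=> h1 h2 i iM; rewrite !coefM; apply: eq_bigr => j _.
rewrite h1 ?h2 //; last exact: leq_ltn_trans (leq_ord j) iM.
exact: leq_ltn_trans (leq_subr _ _) iM.
Qed.

Lemma eqX_sum M (I : Type) (s : seq I) (P : pred I) (F G : I -> {poly A}) :
  (forall i, P i -> eqX M (F i) (G i)) ->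
  eqX M (\sum_(i <- s | P i) F i) (\sum_(i <- s | P i) G i).
Proof.
by move=> h k kM; rewrite !coef_sum; apply: eq_bigr => i Pi; apply: h.
Qed.

Lemma eqX_mulXn M k p p' : eqX M p p' -> eqX (k + M) ('X^k * p) ('X^k * p').
Proof.
move=> h i iM; rewrite !coefXnM; case: ltnP => // ki.
by apply: h; rewrite ltn_subLR.
Qed.

Lemma eqX_Xn0 M k p : (M <= k)%N -> eqX M ('X^k * p) 0.
Proof. by move=> Mk i iM; rewrite coefXnM (leq_trans iM Mk) coef0. Qed.

Lemma eqX_qbin_fact s r : (r <= s)%N ->
  eqX (s.+1 - r) (\prod_(j < r) (1 - 'X^(s - j))) (1 : {poly A}).
Proof.
elim: r => [|r IHr] rs; first by rewrite big_ord0.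
rewrite big_ord_recr /= -[1 in X in eqX _ _ X](mulr1 1).
apply: eqX_mul => [i iM|i iM]; first by apply: (IHr (ltnW rs)); lia.
by rewrite coefB coefXn; case: eqP; [lia | rewrite subr0].
Qed.

Lemma polyX_reg s p : (1 - 'X^(s.+1)) * p = 0 -> p = 0.
Proof.
move=> h; apply/polyP => i; rewrite coef0.
have [k] := ubnP i; elim: k i => // k IHk i ik.
have : ((1 - 'X^(s.+1)) * p)`_i = 0 by rewrite h coef0.
rewrite mulrBl mul1r coefB coefXnM; case: ltnP => [_|si]; first by rewrite subr0.
by rewrite (IHk (i - s.+1)%N) ?subr0 //; lia.
Qed.

End Truncation.

Section Multiplicity.
Variables (K : comNzRingType) (q : K) (n : nat).

Fixpoint mult_coef (a : nat -> K) (r f : nat) : K :=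
  if r is r'.+1 then
    \sum_(i < n) (q ^+ r) ^+ (f <= i)%N * (a i * mult_coef a r' i)
  else 1.

Lemma mult_coefS (a : nat -> K) r f : (f < n)%N ->
  mult_coef a r.+1 f.+1 =
    mult_coef a r.+1 f + (1 - q ^+ r.+1) * a f * mult_coef a r f.
Proof.
move=> fn; apply/eqP; rewrite addrC -subr_eq -mulrA; apply/eqP.
exact: (shift_sum_r (q ^+ r.+1) (fun i => a i * mult_coef a r i)).
Qed.

Lemma mult_coef_per (a : nat -> K) r : mult_coef a r 0 = q ^+ r * mult_coef a r n.
Proof.
case: r => [|r] /=; first by rewrite mul1r.
rewrite mulr_sumr; apply: eq_bigr => i _.
by rewrite leqNgt ltn_ord expr0 mul1r expr1.
Qed.

Definition esym (I : finType) (y : I -> K) (r : nat) : K :=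
  \sum_(S : {set I} | #|S| == r) \prod_(x in S) y x.

Lemma prod1D (R : comNzRingType) (I : finType) (y : I -> R) :
  \prod_x (1 + y x) = \sum_(S : {set I}) \prod_(x in S) y x.
Proof.
rewrite (eq_bigr (fun x => y x + 1)) => [|x _]; last by rewrite addrC.
rewrite bigA_distr; apply: eq_bigr => S _.
by rewrite [RHS]big_mkcond.
Qed.

Lemma coef_prod1D (I : finType) (y : I -> K) r :
  (\prod_x (1 + (y x)%:P * 'X))`_r = esym y r.
Proof.
rewrite prod1D coef_sum /esym [RHS]big_mkcond; apply: eq_bigr => S _.
rewrite big_split /= prodr_const -rmorph_prod coefCM coefXn eq_sym /=.
by case: eqP; rewrite ?mulr1 ?mulr0.
Qed.

Lemma esym_scale (I : finType) (y : I -> K) r c :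
  esym (fun x => c * y x) r = c ^+ r * esym y r.
Proof.
rewrite mulr_sumr; apply: eq_bigr => S /eqP <-.
by rewrite big_split prodr_const.
Qed.

Lemma esym_eq (I : finType) (y z : I -> K) r : y =1 z -> esym y r = esym z r.
Proof. by move=> e; apply: eq_bigr => S _; apply: eq_bigr => x _. Qed.

Lemma telescope_quasi (Q : K) (x : nat -> K) f m :
  \sum_(i < m) Q ^+ (f <= i)%N * (x i.+1 - x i) =
    x (minn f m) - x 0%N + Q * (x m - x (minn f m)).
Proof.
elim: m => [|m IHm]; first by rewrite big_ord0 minn0; ring.
rewrite big_ord_recr /= IHm; case: (leqP f m) => fm.
  by rewrite (minn_idPl (leqW fm)) expr1; ring.
by rewrite (minn_idPr fm) expr0; ring.
Qed.

End Multiplicity.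

Section Elementary.
Variables (A : comNzRingType) (n M : nat) (a : nat -> A).

(* The truncation to [j < M] of the factors of
   \prod_(i < f) (-z a_i)_oo \prod_(i >= f) (-z q a_i)_oo. *)
Definition level_weight (f : nat) (x : 'I_n * 'I_M) : {poly A} :=
  (a x.1)%:P * 'X^(x.2 + (f <= x.1)).

Definition level_esym (r f : nat) : {poly A} := esym (level_weight f) r.

Lemma level_esym0 f : level_esym 0 f = 1.
Proof.
rewrite /level_esym /esym (big_pred1 set0) ?big_set0 // => S.
by rewrite cards_eq0.
Qed.

Lemma level_esym_per r : level_esym r 0 = 'X^r * level_esym r n.
Proof.
rewrite /level_esym -esym_scale; apply: esym_eq => -[i j].
by rewrite /level_weight /= leqNgt ltn_ord addn0 addn1 exprS; ring.
Qed.

Lemma level_prodE f : \prod_x (1 + (level_weight f x)%:P * 'X) =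
  \prod_(i < n) \prod_(j < M) (1 + ((a i)%:P * 'X^(j + (f <= i)))%:P * 'X).
Proof. by rewrite pair_big. Qed.

Lemma level_prodS f : (f < n)%N ->
  \prod_x (1 + (level_weight f.+1 x)%:P * 'X) * (1 + ((a f)%:P * 'X^M)%:P * 'X) =
  \prod_x (1 + (level_weight f x)%:P * 'X) * (1 + ((a f)%:P)%:P * 'X).
Proof.
move=> fn; rewrite !level_prodE (bigD1 (Ordinal fn)) //=.
rewrite [in RHS](bigD1 (Ordinal fn)) //= ltnn leqnn.
have -> : \prod_(i < n | i != Ordinal fn)
       \prod_(j < M) (1 + ((a i)%:P * 'X^(j + (f < i)))%:P * 'X) =
   \prod_(i < n | i != Ordinal fn)
       \prod_(j < M) (1 + ((a i)%:P * 'X^(j + (f <= i)))%:P * 'X).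
  apply: eq_bigr => i; rewrite -val_eqE /= => ne_if.
  by rewrite (_ : (f < i)%N = (f <= i)%N) //; lia.
set P := \prod_(i < n | _) _.
rewrite -!mulrA ![P * _]mulrC !mulrA; congr (_ * _).
transitivity (\prod_(j < M.+1) (1 + ((a f)%:P * 'X^j)%:P * 'X)).
  rewrite big_ord_recr /=; congr (_ * _).
  by apply: eq_bigr => j _; rewrite addn0.
rewrite big_ord_recl /= expr0 mulr1 mulrC; congr (_ * _).
by apply: eq_bigr => j _; rewrite addn1.
Qed.

Lemma level_esymS r f : (f < n)%N ->
  eqX M (level_esym r.+1 f.+1 - level_esym r.+1 f) ((a f)%:P * level_esym r f).
Proof.
move=> fn; have := congr1 (fun p : {poly {poly A}} => p`_r.+1) (level_prodS fn).
rewrite !mulrDr !mulr1 !coefD !mulrA !coefMX /= !(mulrC _ (_ %:P)) !coefCM.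
rewrite !coef_prod1D -!/(level_esym _ _) => e.
apply: (@eqX_trans _ _ _ ((a f)%:P * level_esym r f
                     - 'X^M * ((a f)%:P * level_esym r f.+1))).
  by move=> i _; congr (nth _ (polyseq _) _); apply: (eq_lincomb (c := 1) e); ring.
rewrite -[X in eqX _ _ X]subr0; apply: eqX_sub; first exact: eqX_refl.
exact: eqX_Xn0.
Qed.

Lemma mult_coef_esym r f : (f <= n)%N ->
  eqX M (mult_coef 'X n (fun i => (a i)%:P) r f)
        (qfact 'X r * level_esym r f).
Proof.
elim: r f => [|r IHr] f fn.
  by rewrite /= level_esym0 /qfact big_ord0 mulr1; apply: eqX_refl.
rewrite qfactS /=.
apply: (@eqX_trans _ _ _ (qfact 'X r * \sum_(i < n)
   ('X^(r.+1)) ^+ (f <= i)%N * (level_esym r.+1 i.+1 - level_esym r.+1 i))).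
  rewrite mulr_sumr; apply: eqX_sum => i _.
  rewrite [qfact _ _ * _]mulrCA; apply: eqX_mul; first exact: eqX_refl.
  apply: (@eqX_trans _ _ _ (qfact 'X r * ((a i)%:P * level_esym r i))).
    rewrite [qfact _ _ * _]mulrCA; apply: eqX_mul; first exact: eqX_refl.
    by apply: IHr; apply: ltnW.
  by apply: eqX_mul; [exact: eqX_refl | apply/eqX_sym/level_esymS].
rewrite (telescope_quasi _ (fun i => level_esym r.+1 i)).
rewrite (minn_idPl fn) level_esym_per.
by move=> i _; congr (nth _ (polyseq _) _); ring.
Qed.

End Elementary.

Section LimitForm.
Variables (A : comNzRingType) (n : nat) (a b : nat -> A).

Let U := mult_coef 'X n (fun i => (a i)%:P).
(* Reversing the order of the indices turns the recurrence of [V] into that of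
   [U]. *)
Let V r g := mult_coef 'X n (fun i => (b (n - i.+1)%N)%:P) r (n - g).

Lemma transfer_pairing s : (0 < n)%N -> (forall i, (i < n)%N -> a i * b i = 1) ->
  transfer 'X n (fun i => (a i)%:P) (fun i => (b i)%:P) s 0 0 = pairing 'X U V s 0 0.
Proof.
move=> n_gt0 abK.
rewrite (@transferE _ 'X n _ _ U V) //.
- exact: polyX_reg.
- by move=> i ni; rewrite -polyCM abK.
- by move=> r f; apply: mult_coefS.
- move=> r g ng; rewrite /V -(subnSK ng) mult_coefS; last by lia.
  by rewrite subnSK // subKn // ltnW.
- exact: mult_coef_per.
- by move=> r; rewrite /V subnn subn0 mult_coef_per.
Qed.

Definition double_esym (M s : nat) : {poly A} :=
  \sum_(r < s.+1) 'X^r * (level_esym n M a r n * level_esym n M b r n).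

Lemma level_esym_rev M r :
  level_esym n M (fun i => b (n - i.+1)%N) r n = level_esym n M b r n.
Proof.
rewrite /level_esym -!coef_prod1D !level_prodE; congr (nth _ (polyseq _) _).
rewrite [RHS](reindex_inj rev_ord_inj) /=; apply: eq_bigr => i _.
have ni : (n <= i)%N = false by rewrite leqNgt ltn_ord.
have ni' : (n <= n - i.+1)%N = false by have := ltn_ord i; lia.
by apply: eq_bigr => j _; rewrite ni ni'.
Qed.

Lemma transfer_esym M s : (0 < n)%N -> (M <= s)%N ->
    (forall i, (i < n)%N -> a i * b i = 1) ->
  eqX M (transfer 'X n (fun i => (a i)%:P) (fun i => (b i)%:P) s 0 0)
        (qfact 'X s * double_esym M s).
Proof.
move=> n_gt0 Ms abK; rewrite transfer_pairing // /pairing mulr_sumr.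
apply: eqX_sum => r _; have rs := ltnSE (ltn_ord r).
pose u := level_esym n M a r n; pose v := level_esym n M b r n.
rewrite -[level_esym n M a r n]/u -[level_esym n M b r n]/v.
have eU : eqX M (U r 0) ('X^r * (qfact 'X r * u)).
  rewrite /U mult_coef_per; apply: eqX_mul; first exact: eqX_refl.
  exact: mult_coef_esym.
have eV : eqX M (V r 0) (qfact 'X r * v).
  by rewrite /V subn0 /v -level_esym_rev; apply: mult_coef_esym.
apply: eqX_trans; first exact: (eqX_mul (@eqX_refl _ M _) (eqX_mul eU eV)).
apply: (@eqX_trans _ _ _ ('X^r * (\prod_(j < r) (1 - 'X^(s - j)))
    * (qfact 'X s * (u * v)))).
  move=> i _; congr (nth _ (polyseq _) _).
  by apply: (eq_lincomb (c := 'X^r * u * v) (kap_fact 'X rs)); ring.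
apply: (@eqX_trans _ _ _ ('X^r * 1 * (qfact 'X s * (u * v)))).
  apply: eqX_mul; last exact: eqX_refl.
  move=> i iM; apply: (@eqX_mulXn A (s.+1 - r) r _ _ (@eqX_qbin_fact A s r rs) i).
  by lia.
by move=> i _; congr (nth _ (polyseq _) _); ring.
Qed.


End LimitForm.

Lemma big_bij_seq (R : Type) (idx : R) (op : Monoid.com_law idx)
    (T1 T2 : eqType) (s1 : seq T1) (s2 : seq T2)
    (P1 : pred T1) (P2 : pred T2) (F1 : T1 -> R) (F2 : T2 -> R)
    (f : T1 -> T2) (g : T2 -> T1) :
    uniq s1 -> uniq s2 ->
    (forall x, x \in s1 -> P1 x ->
       [/\ f x \in s2, P2 (f x), F2 (f x) = F1 x & g (f x) = x]) ->
    (forall y, y \in s2 -> P2 y -> [/\ g y \in s1, P1 (g y) & f (g y) = y]) ->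
  \big[op/idx]_(x <- s1 | P1 x) F1 x = \big[op/idx]_(y <- s2 | P2 y) F2 y.
Proof.
move=> u1 u2 hf hg; rewrite -big_filter -[RHS]big_filter.
have -> : \big[op/idx]_(x <- filter P1 s1) F1 x =
    \big[op/idx]_(y <- map f (filter P1 s1)) F2 y.
  rewrite big_map; apply: eq_big_seq => x; rewrite mem_filter => /andP[Px xs].
  by have [_ _ ->] := hf x xs Px.
apply: perm_big; apply: uniq_perm; last 1 first.
- move=> y; apply/mapP/idP => [[x]|]; rewrite mem_filter => /andP[].
    by move=> Px xs ->; have [fs Pf _ _] := hf x xs Px; rewrite mem_filter Pf.
  move=> Py ys; have [gs Pg fg] := hg y ys Py.
  by exists (g y); rewrite ?mem_filter ?Pg.
- rewrite map_inj_in_uniq ?filter_uniq // => x y.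
  rewrite !mem_filter => /andP[Px xs] /andP[Py ys] fxy.
  by have [_ _ _ <-] := hf x xs Px; have [_ _ _ <-] := hf y ys Py; rewrite fxy.
- exact: filter_uniq.
Qed.

(** * Partitions of P_n as words *)

Section BseqList.
Variables (X : finType) (Y : eqType) (m : nat) (f : X -> Y).

Definition bseq_list : seq (seq Y) :=
  [seq map f (bseqval t) | t <- enum {: m.-bseq X}].

Lemma bseq_list_uniq : injective f -> uniq bseq_list.
Proof.
move=> f_inj; rewrite map_inj_uniq ?enum_uniq // => t t' /(inj_map f_inj).
exact: val_inj.
Qed.

Lemma mem_bseq_list s :
  (size s <= m)%N -> {subset s <= codom f} -> s \in bseq_list.
Proof.
move=> sm sf; have [t et] : exists t, s = map f t.
  elim: s {sm} sf => [|y s IHs] sf; first by exists [::].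
  have /codomP[x ->] : y \in codom f by apply: sf; apply: mem_head.
  have [t ->] : exists t, s = map f t.
    by apply: IHs => z zs; apply: sf; rewrite inE zs orbT.
  by exists (x :: t).
rewrite et size_map in sm *; apply/mapP.
by exists (Bseq sm); rewrite ?mem_enum.
Qed.

Lemma big_bseq_list (R : Type) (idx : R) (op : Monoid.com_law idx)
    (P : pred (seq Y)) (F : seq Y -> R) :
  \big[op/idx]_(t : m.-bseq X | P (map f (bseqval t))) F (map f (bseqval t)) =
  \big[op/idx]_(s <- bseq_list | P s) F s.
Proof. by rewrite /bseq_list big_map big_enum_cond. Qed.

End BseqList.

Section Parts.
Variable n : nat.
Implicit Types (x y z : cpart n) (s r : seq (cpart n)).

Lemma DeltaE (c c' : colour n) : Delta c c' = (ndelta c.1 c.2 c'.1 c'.2)%:Z.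
Proof.
case: c c' => [i k] [i' k']; rewrite /Delta /ndelta /= -!val_eqE /=.
by lia.
Qed.

(* [x] may be followed by [y] in a partition of P_n. *)
Definition step x y : bool := (y.1 + ndelta x.2.1 x.2.2 y.2.1 y.2.2 <= x.1)%N.

Lemma stepE x y : (Delta x.2 y.2 <= x.1%:Z - y.1%:Z) = step x y.
Proof. by rewrite DeltaE /step; apply/idP/idP; lia. Qed.

Lemma inPE s : inP s = all (fun x => 0 < x.1)%N s && sorted step s.
Proof.
congr (_ && _); case: s => //= x s.
by apply: eq_path => {}x y; exact: stepE.
Qed.

Lemma step_le x y : step x y -> (y.1 <= x.1)%N.
Proof. by rewrite /step; lia. Qed.

Definition plist (m : nat) : seq (seq (cpart n)) :=
  bseq_list m (@cpart_of_ord n m).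

Lemma plist_uniq m : uniq (plist m).
Proof.
by apply: bseq_list_uniq => -[p c] [p' c'] [/val_inj -> ->].
Qed.

Lemma mem_plist m s :
  (size s <= m)%N -> all (fun x => x.1 <= m)%N s -> s \in plist m.
Proof.
move=> sm /allP s_le; apply: mem_bseq_list => // -[p c] /s_le pm.
by apply/codomP; exists (inord p, c); rewrite /cpart_of_ord /= inordK.
Qed.

Lemma weight_bound s m : all (fun x => 0 < x.1)%N s -> weightP s = m ->
  (size s <= m)%N /\ all (fun x => x.1 <= m)%N s.
Proof.
move=> s_gt0 <-; split; first exact: size_le_sum.
by apply/allP => x xs; apply: (le_sum_seq (fun x => x.1)).
Qed.

Lemma mem_plist_weight m s : inP s -> weightP s = m -> s \in plist m.
Proof.
by case/andP=> s_gt0 _ /(weight_bound s_gt0) [? ?]; apply: mem_plist.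
Qed.

End Parts.

Section Words.
Variables (A : comNzRingType) (n M : nat) (a b : nat -> A).
Implicit Types (x y z : cpart n) (s r : seq (cpart n)).

Definition letters : seq (cpart n) :=
  [seq (p, c) | p <- index_iota 0 M, c <- enum {: colour n}].

Fixpoint words (k : nat) : seq (seq (cpart n)) :=
  if k is k'.+1 then [seq y :: r | y <- letters, r <- words k'] else [:: [::]].

Definition cweight (c : colour n) : A := a c.1 * b c.2.

Definition smono s : A := \prod_(x <- s) cweight x.2.

(* Words list the parts in increasing order. *)
Definition climb x y := step y x.

Definition word_sum (k : nat) x : {poly A} :=
  \sum_(r <- words k | path climb x r) (smono r)%:P * 'X^(weightP r).

Lemma letters_uniq : uniq letters.
Proof. by apply: allpairs_uniq; rewrite ?iota_uniq ?enum_uniq // => -[? ?] [? ?]. Qed.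

Lemma mem_letters x : (x \in letters) = (x.1 < M)%N.
Proof.
case: x => p c; apply/allpairsP/idP => [[[p' c'] [] /=]|pM].
  by rewrite mem_index_iota => ? _ [-> _].
by exists (p, c); rewrite mem_index_iota mem_enum.
Qed.

Lemma words_uniq k : uniq (words k).
Proof.
elim: k => //= k IHk; apply: allpairs_uniq => //; first exact: letters_uniq.
by move=> [? ?] [? ?] _ _ [-> ->].
Qed.

Lemma mem_words k r : (r \in words k) = (size r == k) && all (fun x => x.1 < M)%N r.
Proof.
elim: k r => [|k IHk] r; first by rewrite inE; case: r.
apply/allpairsP/idP => [[[y t] /= [yl tk ->]]|] /=.
  by rewrite /= eqSS -mem_letters andbCA -IHk tk yl.
case: r => //= y r /andP[rk /andP[yM rM]]; exists (y, r).
by rewrite /= mem_letters IHk yM rM -eqSS rk.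
Qed.

Lemma word_sum0 x : word_sum 0 x = 1.
Proof.
by rewrite /word_sum /= big_mkcond big_seq1 /= /smono /weightP !big_nil mulr1.
Qed.

Lemma word_sumS k x : word_sum k.+1 x =
  \sum_(y <- letters | climb x y) (cweight y.2)%:P * 'X^(y.1) * word_sum k y.
Proof.
rewrite /word_sum /= big_mkcond big_allpairs_dep [RHS]big_mkcond.
apply: eq_bigr => y _ /=; case: (climb x y) => /=; last by rewrite big1.
rewrite -big_mkcond mulr_sumr; apply: eq_bigr => r _.
by rewrite /smono /weightP !big_cons polyCM exprD; ring.
Qed.

Lemma geometric_tail (K : comNzRingType) (Q : K) d m :
  (1 - Q) * \sum_(p < m | (d <= p)%N) Q ^+ p = Q ^+ (minn d m) - Q ^+ m.
Proof.
elim: m => [|m IHm]; first by rewrite big_ord0 minn0 mulr0 subrr.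
rewrite big_mkcond big_ord_recr -big_mkcond /= mulrDr IHm.
case: (leqP d m) => dm; first by rewrite (minn_idPl (leqW dm)) exprS; ring.
by rewrite (minn_idPr dm) mulr0 addr0 !subrr.
Qed.

Lemma word_sumE k x :
  eqX M (qfact 'X k * word_sum k x * (cweight x.2)%:P)
        ('X^(k * x.1) * transfer 'X n (fun i => (a i)%:P) (fun i => (b i)%:P)
                                 k x.2.1 x.2.2).
Proof.
elim: k x => [|k IHk] [p0 c0] /=.
  by rewrite /qfact big_ord0 word_sum0 /cweight polyCM !mul1r.
pose T (c : colour n) := transfer 'X n (fun i => (a i)%:P) (fun i => (b i)%:P) k c.1 c.2.
pose d (c : colour n) := ndelta c.1 c.2 c0.1 c0.2.
have -> : qfact 'X k.+1 * word_sum k.+1 (p0, c0) * (cweight c0)%:P =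
   (cweight c0)%:P * \sum_(c : colour n) (1 - 'X^(k.+1)) *
      \sum_(p < M | (p0 + d c <= p)%N)
          'X^p * (qfact 'X k * word_sum k (nat_of_ord p, c) * (cweight c)%:P).
  rewrite qfactS word_sumS big_mkcond big_allpairs /= big_mkord exchange_big /=.
  rewrite big_enum /=; set S := \sum_(c : colour n) _.
  transitivity ((cweight c0)%:P * ((1 - 'X^(k.+1)) * qfact 'X k * S)); first by ring.
  congr (_ * _); rewrite mulr_sumr; apply: eq_bigr => c _.
  rewrite -mulrA; congr (_ * _); rewrite mulr_sumr [RHS]big_mkcond.
  apply: eq_bigr => p _; rewrite /climb /step /= addnC.
  by case: ifP => _; ring.
apply: (@eqX_trans _ _ _ ((cweight c0)%:P * \sum_(c : colour n)
     T c * ((1 - 'X^(k.+1)) * \sum_(p < M | (p0 + d c <= p)%N) 'X^(k.+1) ^+ p))).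
  apply: eqX_mul; first exact: eqX_refl.
  apply: eqX_sum => c _; rewrite [T c * _]mulrCA.
  apply: eqX_mul; first exact: eqX_refl.
  rewrite mulr_sumr; apply: eqX_sum => p _.
  apply: (@eqX_trans _ _ _ ('X^p * ('X^(k * p) * T c))).
    by apply: eqX_mul; [exact: eqX_refl | exact: (IHk (nat_of_ord p, c))].
  by move=> i _; congr (nth _ (polyseq _) _); rewrite -exprM mulSn exprD; ring.
apply: (@eqX_trans _ _ _ ((cweight c0)%:P * \sum_(c : colour n)
     T c * 'X^(k.+1 * (p0 + d c)))).
  apply: eqX_mul; first exact: eqX_refl.
  apply: eqX_sum => c _; apply: eqX_mul; first exact: eqX_refl.
  rewrite geometric_tail -!exprM; case: (leqP (p0 + d c) M) => pM.
    rewrite -[X in eqX _ _ X]subr0.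
    apply: eqX_sub; first exact: eqX_refl.
    by rewrite -[X in eqX _ X _]mulr1; apply: eqX_Xn0; apply: leq_pmull.
  rewrite subrr; apply: eqX_sym.
  rewrite -[X in eqX _ X _]mulr1; apply: eqX_Xn0.
  by apply: (leq_trans (ltnW pM)); apply: leq_pmull.
move=> i _; congr (nth _ (polyseq _) _).
rewrite (pair_big xpredT xpredT) /= [cweight _]/(a _ * b _) polyCM mulrCA; congr (_ * _).
rewrite mulr_sumr; apply: eq_bigr => c _.
by rewrite mulnDr exprD /T; ring.
Qed.

End Words.

Section Padding.
Variables (A : comNzRingType) (n M : nat) (a b : nat -> A).
Hypothesis ab0 : a 0%N * b 0%N = 1.
Implicit Types (x y z : cpart n.+1) (s r : seq (cpart n.+1)).

Let z0 : cpart n.+1 := (0%N, (ord0, ord0)).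

Lemma step_z0 x : step x z0 = (0 < x.1)%N || (x == z0).
Proof.
case: x => p [i k]; rewrite /step /ndelta /z0 /= !xpair_eqE -!val_eqE /=.
by case: (val i) (val k) => [|i'] [|k'] /=; lia.
Qed.

Lemma climb_pos x r : (0 < x.1)%N -> path (@climb _) x r ->
  all (fun y => 0 < y.1)%N r.
Proof.
elim: r x => //= y r IHr x x_gt0 /andP[/step_le xy yr].
by have y_gt0 := leq_trans x_gt0 xy; rewrite y_gt0 (IHr y).
Qed.

Lemma climb_split r : path (@climb _) z0 r ->
  exists2 k, r = nseq k z0 ++ filter (fun x => 0 < x.1)%N r &
             (size r = k + size (filter (fun x => 0 < x.1)%N r))%N.
Proof.
elim: r => [|y r IHr] /=; first by exists 0%N.
case/andP; rewrite /climb step_z0; case: (posnP y.1) => [y0 /= /eqP -> /IHr[k]|].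
  by move=> e1 e2; exists k.+1; rewrite /= -?e1 // e2.
move=> y_gt0 _ /(climb_pos y_gt0)/all_filterP ->.
by exists 0%N.
Qed.

Lemma coef_word_sum k m : (m <= k)%N -> (m < M)%N ->
  (word_sum M a b k z0)`_m =
  \sum_(s <- plist n.+1 m | inP s && (weightP s == m)) smono a b s.
Proof.
move=> mk mM; rewrite /word_sum coef_sum.
under eq_bigr do rewrite coefCM coefXn.
transitivity (\sum_(r <- words n.+1 M k | path (@climb _) z0 r && (weightP r == m))
    smono a b r).
  rewrite big_mkcondr; apply: eq_bigr => r _; rewrite eq_sym.
  by case: eqP; rewrite ?mulr1 ?mulr0.
pose pos := fun x => (0 < x.1)%N.
have weight_cat u v : weightP (u ++ v) = (weightP u + weightP v)%N.
  by rewrite /weightP big_cat.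
have weight_z k' : weightP (nseq k' z0) = 0%N.
  by rewrite /weightP big_nseq; elim: k' => //= k' ->.
have weight_rev u : weightP (rev u) = weightP u.
  by rewrite /weightP; apply: perm_big; rewrite perm_rev.
have smono_pad k' u : smono a b (nseq k' z0 ++ u) = smono a b u.
  rewrite /smono big_cat big1_seq /= ?mul1r // => x /nseqP[-> _].
  exact: ab0.
symmetry; apply: (@big_bij_seq _ _ _ _ _ _ _ _ _ _ _
  (fun s => nseq (k - size s) z0 ++ rev s) (fun r => rev (filter pos r))).
- exact: plist_uniq.
- exact: words_uniq.
- move=> s _ /andP[]; rewrite inPE => /andP[s_pos s_sorted] /eqP sm.
  have [size_s le_s] := weight_bound s_pos sm.
  split.
  + rewrite mem_words size_cat size_nseq size_rev subnK ?(leq_trans size_s) // eqxx.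
    rewrite all_cat all_rev all_nseq (leq_ltn_trans (leq0n m) mM) orbT /=.
    by apply: sub_all le_s => x xm; apply: leq_ltn_trans xm mM.
  + rewrite weight_cat weight_z weight_rev sm eqxx andbT cat_path.
    have -> : last z0 (nseq (k - size s) z0) = z0 by elim: (k - _)%N.
    apply/andP; split.
      by elim: (k - _)%N => //= k' ->; rewrite /climb step_z0 eqxx orbT.
    rewrite -[path _ _ _]/(sorted (@climb _) (z0 :: rev s)) -rev_rcons rev_sorted.
    case: s s_pos s_sorted {sm size_s le_s} => //= x s /andP[x_gt0 s_pos] xs.
    rewrite rcons_path xs /climb step_z0; case/lastP: s s_pos {xs} => [|s y] /=.
      by rewrite x_gt0.
    by rewrite all_rcons last_rcons => /andP[->].
  + rewrite smono_pad /smono; apply: perm_big; exact: permEl (perm_rev s).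
  + rewrite filter_cat filter_rev (all_filterP s_pos).
    rewrite (eq_in_filter (a2 := pred0)) ?filter_pred0 ?revK // => x.
    by move/nseqP => [-> _].
- move=> r; rewrite mem_words => /andP[/eqP rk rM] /andP[rp /eqP rm].
  have [k' er size_r] := climb_split rp.
  have fm : weightP (filter pos r) = m by rewrite -rm {2}er weight_cat weight_z.
  have fP : inP (rev (filter pos r)).
    rewrite inPE all_rev filter_all rev_sorted /=.
    move: rp; rewrite er filter_cat; set t := filter pos r => h.
    have -> : filter pos t = t by rewrite /t filter_id.
    rewrite (_ : filter pos (nseq k' z0) = [::]); last by elim: (k').
    move: h; rewrite cat_path => /andP[_]; exact: path_sorted.
  have fw : weightP (rev (filter pos r)) = m by rewrite weight_rev.
  split; [exact: mem_plist_weight | by rewrite fP fw eqxx |].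
  rewrite revK size_rev [RHS]er; congr (nseq _ _ ++ _).
  by rewrite -rk size_r addnK.
Qed.

End Padding.

(** * Free parts and forbidden patterns *)

Section Slots.
Variable n : nat.
Implicit Types (x y z : cpart n.+1) (s B F L : seq (cpart n.+1)) (p : nat).

(* Among the parts of size [p], bound colours with [k < l] come before the free
   parts, which come before bound colours with [k > l]. *)
Definition bef p x := (p < x.1)%N || ((x.1 == p) && (x.2.1 < x.2.2)%N).
Definition fre p x := (x.1 == p) && (x.2.1 == x.2.2 :> nat).
Definition aft p x := (x.1 < p)%N || ((x.1 == p) && (x.2.2 < x.2.1)%N).

Definition rank p x : nat := if bef p x then 0 else if fre p x then 1 else 2.

Lemma befE p x : bef p x = (rank p x == 0%N).
Proof. by rewrite /rank; case: ifP => // _; case: ifP. Qed.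

Lemma freE p x : fre p x = (rank p x == 1%N).
Proof. by rewrite /rank /fre /bef; do 2?case: ifP => //=; lia. Qed.

Lemma aftE p x : aft p x = (rank p x == 2%N).
Proof. by rewrite /rank /aft /fre /bef; do 2?case: ifP => //=; lia. Qed.

Lemma rank_mono p x y : step x y -> (rank p x <= rank p y)%N.
Proof.
rewrite /step /ndelta /rank /fre /bef.
by do 4?case: ifP => //=; lia.
Qed.

Definition by_rank p := relpre (rank p) leq.

Lemma by_rank_trans p : transitive (by_rank p).
Proof. by move=> y x z; apply: leq_trans. Qed.

Lemma sorted_by_rank p s : sorted (@step _) s -> pairwise (by_rank p) s.
Proof.
rewrite -sorted_pairwise; last exact: by_rank_trans.
by apply: sub_sorted => x y; apply: rank_mono.
Qed.

Lemma filter_split p B F L : all (bef p) B -> all (fre p) F -> all (aft p) L ->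
  [/\ filter (bef p) (B ++ F ++ L) = B, filter (fre p) (B ++ F ++ L) = F
    & filter (aft p) (B ++ F ++ L) = L].
Proof.
have nil s (P Q : pred (cpart n.+1)) : all P s -> (forall x, P x -> ~~ Q x) ->
    filter Q s = [::].
  move=> /allP h PQ; rewrite (eq_in_filter (a2 := pred0)) ?filter_pred0 // => x xs.
  exact/negbTE/PQ/h.
move=> hB hF hL; split; rewrite !filter_cat.
- rewrite (all_filterP hB) (nil F (fre p)) ?(nil L (aft p)) ?cats0 // => x;
    by rewrite ?freE ?aftE befE => /eqP ->.
- rewrite (all_filterP hF) (nil B (bef p)) ?(nil L (aft p)) ?cats0 // => x;
    by rewrite ?befE ?aftE freE => /eqP ->.
- rewrite (all_filterP hL) (nil B (bef p)) ?(nil F (fre p)) // => x;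
    by rewrite ?befE ?freE aftE => /eqP ->.
Qed.

Lemma split_level p s : sorted (@step _) s ->
  s = filter (bef p) s ++ filter (fre p) s ++ filter (aft p) s.
Proof.
move/(sorted_by_rank p); elim: s => //= x s IHs /andP[/allP xs /IHs e].
have sub q (Q : pred (cpart n.+1)) : (forall y, Q y = (rank p y == q)) ->
    (q < rank p x)%N -> filter Q s = [::].
  move=> QE qx; rewrite (eq_in_filter (a2 := pred0)) ?filter_pred0 // => y /xs.
  by rewrite /= QE => /(leq_trans qx); case: ltngtP.
have hb := sub 0%N _ (befE p); have hf := sub 1%N _ (freE p).
have r2 : (rank p x <= 2)%N by rewrite /rank; do 2?case: ifP.
rewrite befE freE aftE {1}e; case: (rank p x) hb hf r2 => [|[|[|r]]] //=.
  by move=> ->.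
by move=> -> // ->.
Qed.

Lemma fre_step_eq p x y : fre p x -> fre p y -> step x y -> x = y.
Proof.
case: x y => [px [k1 l1]] [py [k2 l2]]; rewrite /fre /step /ndelta /=.
move=> /andP[/eqP -> e1] /andP[/eqP -> e2] h.
by congr (_, (_, _)); apply/val_inj => /=; lia.
Qed.

Lemma fre_pair p y : fre p y -> y = (p, (y.2.1, y.2.1)).
Proof.
case: y => q [i k] /= /andP[/= /eqP -> /eqP ik].
by rewrite (val_inj ik).
Qed.

Lemma step_triangle p x y z : fre p y -> step x y -> step y z -> step x z.
Proof.
move=> /andP[_ /eqP ky]; rewrite /step ky => xy yz.
have := ndelta_triangle x.2.1 x.2.2 y.2.2 z.2.1 z.2.2.
by lia.
Qed.

Lemma step_free_refl p y : fre p y -> step y y.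
Proof. by rewrite /fre /step /ndelta; lia. Qed.

Let c00 : colour n.+1 := (ord0, ord0).
(* Virtual neighbours at the two ends of a partition. *)
Definition far p : cpart n.+1 := (p.+2, c00).
Definition ground : cpart n.+1 := (0%N, c00).

Lemma bef_far p : bef p (far p). Proof. by rewrite /bef /=; lia. Qed.

Lemma aft_ground p : (0 < p)%N -> aft p ground.
Proof. by rewrite /aft /= => ->. Qed.

Lemma step_far p y : aft p y || fre p y -> step (far p) y.
Proof. by rewrite /aft /fre /step /ndelta /=; lia. Qed.

Lemma step_ground p x : (0 < p)%N -> bef p x || fre p x -> step x ground.
Proof. by move=> p_gt0; rewrite /bef /fre /step /ndelta /=; lia. Qed.

Lemma sorted_cons3 p B y L : sorted (@step _) (B ++ y :: L) =
  [&& sorted (@step _) B, (B == [::]) || step (last (far p) B) y & path (@step _) y L].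
Proof. by case: B => //= x B; rewrite cat_path. Qed.

Lemma path_head p y L : (0 < p)%N -> fre p y -> path (@step _) y L =
  step y (head ground L) && sorted (@step _) L.
Proof.
move=> p_gt0 py; case: L => //=.
by rewrite (step_ground p_gt0) // py orbT.
Qed.

Lemma sorted_slot p B y L : (0 < p)%N -> fre p y -> sorted (@step _) (B ++ y :: L) =
  [&& sorted (@step _) B, step (last (far p) B) y, step y (head ground L)
    & sorted (@step _) L].
Proof.
move=> p_gt0 py; rewrite (sorted_cons3 p) (path_head _ p_gt0) //.
congr (_ && _); congr (_ && _); case: eqP => [->|] //=.
by rewrite step_far // py orbT.
Qed.

Lemma sorted_cat_slot p B L : (0 < p)%N -> all (bef p) B -> all (aft p) L ->
  sorted (@step _) (B ++ L) =
  [&& sorted (@step _) B, step (last (far p) B) (head ground L)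
    & sorted (@step _) L].
Proof.
move=> p_gt0; case: L => [|z L] hB /= => [_|/andP[pz _]].
  rewrite cats0 andbT (step_ground p_gt0) ?andbT //.
  by case/lastP: B hB => [|B x]; rewrite ?bef_far // all_rcons last_rcons => /andP[->].
rewrite (sorted_cons3 p); congr (_ && _); case: eqP => [->|] //=.
by rewrite step_far ?pz.
Qed.

Lemma all_bef_last p B : all (bef p) B -> bef p (last (far p) B).
Proof.
by case/lastP: B => [|B x]; rewrite ?bef_far // all_rcons last_rcons => /andP[].
Qed.

Lemma all_aft_head p L : (0 < p)%N -> all (aft p) L -> aft p (head ground L).
Proof. by move=> p_gt0; case: L => [|z L] /=; rewrite ?aft_ground // => /andP[]. Qed.

Section Choice.
Variables (delta : colour n.+1 -> int) (gamma : colour n.+1 -> colour n.+1 -> int).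
Hypotheses (hdelta : condition1 delta) (hgamma : condition2 gamma).

(* The colour of the free part of size [p] that the patterns forbid between the
   neighbours [x] and [z]; [0] stands for [a_0 b_0]. *)
Definition slot p x z : int :=
  if x.1 == p then
    if z.1 == p then gamma x.2 z.2
    else if (p == z.1.+1) && (z.2.1 < z.2.2)%N then gamma x.2 z.2 else delta x.2
  else if z.1 == p then
    if (x.1 == p.+1) && (x.2.2 < x.2.1)%N then gamma x.2 z.2 else delta z.2
  else 0.

Lemma int_ord (g : int) (k : 'I_n.+1) : 0 <= g -> g <= (k : nat)%:Z ->
  exists i : 'I_n.+1, g = (i : nat)%:Z.
Proof.
move=> g0 gk; have lt_gn : (`|g| < n.+1)%N by have := ltn_ord k; lia.
by exists (Ordinal lt_gn) => /=; lia.
Qed.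

Lemma ioc_diffP (l k l' k' i : 'I_n.+1) : (i \in ioc l k :\: ioc l' k') =
  (l < i <= k)%N && ~~ (l' < i <= k')%N.
Proof. by rewrite !inE andbC. Qed.

Lemma slot_fits p x z : (0 < p)%N -> bef p x -> aft p z -> step x z ->
  exists i : 'I_n.+1,
    [/\ slot p x z = (i : nat)%:Z, step x (p, (i, i)) & step (p, (i, i)) z].
Proof.
case: x z => [px [k1 l1]] [pz [k2 l2]] p_gt0.
rewrite /bef /aft /step /slot /=.
case: (eqVneq px p) => [->|px_p]; rewrite ?ltnn /=.
- move=> kl1; have n1 : (k1 != l1 :> nat) by rewrite ltn_eqF.
  have b1 : is_bound (k1, l1) by rewrite /is_bound -val_eqE.
  case: (eqVneq pz p) => [->|pz_p]; rewrite ?ltnn /=.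
    move=> kl2; have n2 : (k2 != l2 :> nat) by rewrite gtn_eqF.
    have b2 : is_bound (k2, l2) by rewrite /is_bound -val_eqE.
    rewrite ndelta_bound // => h.
    have [k12 l21] : (k1 < k2)%N /\ (l2 < l1)%N by split; lia.
    have [h1 _ _] := hgamma b1 b2; move: h1; rewrite /cross /= => h1.
    have {}h1 : (maxn k1 l2)%:Z < gamma (k1, l1) (k2, l2) <= (minn k2 l1)%:Z.
      by apply: h1; rewrite gtn_max !ltn_min kl1 kl2 k12 l21.
    have [i ei] : exists i : 'I_n.+1, gamma (k1, l1) (k2, l2) = (i : nat)%:Z.
      by apply: (int_ord (k := k2)); lia.
    move: h1; rewrite ei lez_nat ltz_nat gtn_max leq_min.
    case/andP=> /andP[ki li] /andP[ik il].
    by exists i; rewrite ndelta_freer // ndelta_freel //; split=> //; lia.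
  case: ifP => [/andP[/eqP -> kl2] _|hz hz' _].
    have n2 : (k2 != l2 :> nat) by rewrite ltn_eqF.
    have b2 : is_bound (k2, l2) by rewrite /is_bound -val_eqE.
    rewrite ndelta_bound // => h; have [_ _ h3] := hgamma b1 b2.
    have [i] : exists2 j : 'I_n.+1, j \in ioc k1 l1 :\: ioc k2 l2
        & gamma (k1, l1) (k2, l2) = (j : nat)%:Z.
      apply: h3 => //; apply/set0Pn.
      case: (leqP l1 l2) => l12.
        have k12 : (k1 < k2)%N by lia.
        have lt_k : (k1.+1 < n.+1)%N by apply: leq_ltn_trans (ltn_ord l1).
        exists (Ordinal lt_k); rewrite ioc_diffP /= ltnSn kl1 /=.
        by rewrite ltnS leqNgt k12.
      by exists l1; rewrite ioc_diffP kl1 leqnn (leqNgt l1) l12 andbF.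
    rewrite ioc_diffP => /andP[/andP[ki il] hi] ->.
    by exists i; rewrite ndelta_freer // ndelta_freel //; split=> //; lia.
  have := hdelta b1; rewrite /= (minn_idPl (ltnW kl1)) (maxn_idPr (ltnW kl1)).
  case/andP=> ki il.
  have [i ei] := int_ord (ltW (le_lt_trans (le0z_nat k1) ki)) il.
  move: ki il; rewrite ei lez_nat ltz_nat => ki il.
  exists i; rewrite ndelta_freer //; split=> //; first by lia.
  case: (eqVneq (k2 : nat) l2) => [<-|n2]; first by rewrite ndelta_free; lia.
  by rewrite ndelta_freel //; lia.
- rewrite orbF => p_px; case: (eqVneq pz p) => [->|pz_p]; rewrite ?ltnn /=.
    move=> kl2; have n2 : (k2 != l2 :> nat) by rewrite gtn_eqF.
    have b2 : is_bound (k2, l2) by rewrite /is_bound -val_eqE.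
    case: ifP => [/andP[/eqP -> kl1]|hx _].
      have n1 : (k1 != l1 :> nat) by rewrite gtn_eqF.
      have b1 : is_bound (k1, l1) by rewrite /is_bound -val_eqE.
      rewrite ndelta_bound // => h; have [_ h2 _] := hgamma b1 b2.
      have [i] : exists2 j : 'I_n.+1, j \in ioc l2 k2 :\: ioc l1 k1
          & gamma (k1, l1) (k2, l2) = (j : nat)%:Z.
        apply: h2 => //; apply/set0Pn.
        case: (leqP k2 k1) => k12.
          have l12 : (l2 < l1)%N by lia.
          have lt_l : (l2.+1 < n.+1)%N by apply: leq_ltn_trans (ltn_ord k2).
          exists (Ordinal lt_l); rewrite ioc_diffP /= ltnSn kl2 /=.
          by rewrite ltnS leqNgt l12.
        by exists k2; rewrite ioc_diffP kl2 leqnn (leqNgt k2) k12 andbF.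
      rewrite ioc_diffP => /andP[/andP[li ik] hi] ->.
      by exists i; rewrite ndelta_freer // ndelta_freel //; split=> //; lia.
    have := hdelta b2; rewrite /= (minn_idPr (ltnW kl2)) (maxn_idPl (ltnW kl2)).
    case/andP=> li ik.
    have [i ei] := int_ord (ltW (le_lt_trans (le0z_nat l2) li)) ik.
    move: li ik; rewrite ei lez_nat ltz_nat => li ik.
    exists i; rewrite (ndelta_freel _ n2); split=> //; last by lia.
    case: (eqVneq (k1 : nat) l1) => [<-|n1]; first by rewrite ndelta_free; lia.
    by rewrite ndelta_freer //; lia.
  rewrite orbF => pz_lt h; exists ord0; split=> //.
    case: (eqVneq (k1 : nat) l1) => [<-|n1]; first by rewrite ndelta_free; lia.
    by rewrite ndelta_freer //=; lia.
  case: (eqVneq (k2 : nat) l2) => [<-|n2]; first by rewrite ndelta_free; lia.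
  by rewrite ndelta_freel //=; lia.
Qed.

Definition slot_in p s : int :=
  slot p (last (far p) (filter (bef p) s)) (head ground (filter (aft p) s)).

Definition slot_part p s : cpart n.+1 :=
  (p, (inord `|slot_in p s|, inord `|slot_in p s|)).

Definition ins p s :=
  let F := filter (fre p) s in
  filter (bef p) s ++ head (slot_part p s) F :: F ++ filter (aft p) s.

Definition del p s :=
  filter (bef p) s ++ behead (filter (fre p) s) ++ filter (aft p) s.

Definition bad p s : bool :=
  if filter (fre p) s is y :: F then
    (F != [::]) || ((y.2.1 : nat)%:Z == slot_in p s)
  else false.

Lemma fre_slot_part p s : fre p (slot_part p s).
Proof. by rewrite /fre /slot_part /= !eqxx. Qed.

Lemma slot_part_fits p s : (0 < p)%N -> sorted (@step _) s ->
    filter (fre p) s = [::] ->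
  [/\ ((slot_part p s).2.1 : nat)%:Z = slot_in p s,
      step (last (far p) (filter (bef p) s)) (slot_part p s)
    & step (slot_part p s) (head ground (filter (aft p) s))].
Proof.
move=> p_gt0 ss F0; have e := split_level p ss; rewrite F0 /= in e.
have hB : all (bef p) (filter (bef p) s) := filter_all _ _.
have hL : all (aft p) (filter (aft p) s) := filter_all _ _.
move: ss; rewrite {1}e (sorted_cat_slot p_gt0 hB hL) => /and3P[_ st _].
have [i [ei s1 s2]] := slot_fits p_gt0 (all_bef_last hB) (all_aft_head p_gt0 hL) st.
by rewrite /slot_part /slot_in ei /= inord_val.
Qed.

Lemma filter_ins p s : let F := filter (fre p) s in
  [/\ filter (bef p) (ins p s) = filter (bef p) s,
      filter (fre p) (ins p s) = head (slot_part p s) F :: F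
    & filter (aft p) (ins p s) = filter (aft p) s].
Proof.
move=> F; rewrite /ins -cat_cons; apply: filter_split; rewrite ?filter_all //=.
rewrite filter_all andbT; case E: (filter (fre p) s) => [|y F'] /=.
  exact: fre_slot_part.
by have := filter_all (fre p) s; rewrite E => /andP[].
Qed.

Lemma filter_del p s :
  [/\ filter (bef p) (del p s) = filter (bef p) s,
      filter (fre p) (del p s) = behead (filter (fre p) s)
    & filter (aft p) (del p s) = filter (aft p) s].
Proof.
apply: filter_split; rewrite ?filter_all //.
by have := filter_all (fre p) s; case: (filter _ _) => //= y F /andP[].
Qed.

Lemma slot_in_ins p s : slot_in p (ins p s) = slot_in p s.
Proof. by rewrite /slot_in; have [-> _ ->] := filter_ins p s. Qed.

Lemma slot_in_del p s : slot_in p (del p s) = slot_in p s.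
Proof. by rewrite /slot_in; have [-> _ ->] := filter_del p s. Qed.

Lemma sorted_ins p s : (0 < p)%N -> sorted (@step _) s -> sorted (@step _) (ins p s).
Proof.
move=> p_gt0 ss; rewrite /ins; case E: (filter (fre p) s) => [|y F] /=.
  have [_ s1 s2] := slot_part_fits p_gt0 ss E.
  rewrite (sorted_slot _ _ p_gt0 (fre_slot_part p s)) s1 s2 /=.
  have e := split_level p ss; move: ss; rewrite {1}e E /=.
  by rewrite (sorted_cat_slot p_gt0) ?filter_all // => /and3P[-> _ ->].
have py : fre p y by have := filter_all (fre p) s; rewrite E => /andP[].
have e := split_level p ss; move: ss; rewrite {1}e E /= !(sorted_cons3 p) /=.
by rewrite (step_free_refl py).
Qed.

Lemma sorted_del p s : (0 < p)%N -> sorted (@step _) s -> sorted (@step _) (del p s).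
Proof.
move=> p_gt0 ss; rewrite /del; have := split_level p ss.
have := filter_all (fre p) s; case E: (filter (fre p) s) => [|y F] /=.
  by move=> _ <-.
case/andP=> py; case: F {E} => [|y' F] /= => [_|/andP[py' _]] e.
  move: ss; rewrite {1}e (sorted_slot _ _ p_gt0 py) => /and4P[s1 s2 s3 s4].
  rewrite (sorted_cat_slot p_gt0) ?filter_all // s1 s4 andbT /=.
  exact: (step_triangle py s2 s3).
move: ss; rewrite {1}e !(sorted_cons3 p) /= => /and3P[-> + /andP[yy' ->]].
by rewrite (fre_step_eq py py' yy') => ->.
Qed.

Lemma inP_ins p s : (0 < p)%N -> inP s -> inP (ins p s).
Proof.
move=> p_gt0; rewrite !inPE => /andP[s_gt0 ss]; rewrite sorted_ins // andbT.
have allf (P : pred (cpart n.+1)) : all (fun x => (0 < x.1)%N) (filter P s).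
  by apply/allP => x; rewrite mem_filter => /andP[_ /(allP s_gt0)].
rewrite /ins all_cat allf /= all_cat !allf !andbT.
by case E: (filter (fre p) s) (allf (fre p)) => [|y F] //= /andP[].
Qed.

Lemma inP_del p s : (0 < p)%N -> inP s -> inP (del p s).
Proof.
move=> p_gt0; rewrite !inPE => /andP[s_gt0 ss]; rewrite sorted_del // andbT.
have allf (P : pred (cpart n.+1)) : all (fun x => (0 < x.1)%N) (filter P s).
  by apply/allP => x; rewrite mem_filter => /andP[_ /(allP s_gt0)].
rewrite /del !all_cat !allf andbT /=.
by case E: (filter (fre p) s) (allf (fre p)) => [|y F] //= /andP[].
Qed.

Lemma inP_sorted s : inP s -> sorted (@step _) s.
Proof. by rewrite inPE => /andP[]. Qed.

Lemma bad_ins p s : (0 < p)%N -> inP s -> bad p (ins p s).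
Proof.
move=> p_gt0 /inP_sorted ss; rewrite /bad; have [_ -> _] := filter_ins p s.
rewrite slot_in_ins; case E: (filter (fre p) s) => [|y F] //=.
by have [-> _ _] := slot_part_fits p_gt0 ss E; rewrite eqxx.
Qed.

Lemma del_ins p s : inP s -> del p (ins p s) = s.
Proof.
move=> /inP_sorted ss; rewrite /del; have [-> -> ->] := filter_ins p s.
by rewrite /= -split_level.
Qed.

Lemma ins_del p s : inP s -> bad p s -> ins p (del p s) = s.
Proof.
move=> /inP_sorted ss; rewrite /ins; have [-> -> ->] := filter_del p s.
rewrite /slot_part slot_in_del /bad [in RHS](split_level p ss).
have := filter_all (fre p) s; have := split_level p ss.
case E: (filter (fre p) s) => [|y F] //= e /andP[py].
case: F e {E} => [|y' F] /= e => [_ /eqP <-|/andP[py' _] _].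
  by rewrite /= inord_val -(fre_pair py).
move: ss; rewrite e (sorted_cons3 p) /= => /and3P[_ _ /andP[yy' _]].
by rewrite (fre_step_eq py py' yy').
Qed.

Lemma slot_far_left p x x' z :
    x.1 != p -> ~~ ((x.1 == p.+1) && (x.2.2 < x.2.1)%N) ->
    x'.1 != p -> ~~ ((x'.1 == p.+1) && (x'.2.2 < x'.2.1)%N) ->
  slot p x z = slot p x' z.
Proof. by rewrite /slot => /negPf -> /negPf -> /negPf -> /negPf ->. Qed.

Lemma slot_far_right p x z z' :
    z.1 != p -> ~~ ((p == z.1.+1) && (z.2.1 < z.2.2)%N) ->
    z'.1 != p -> ~~ ((p == z'.1.+1) && (z'.2.1 < z'.2.2)%N) ->
  slot p x z = slot p x z'.
Proof. by rewrite /slot => /negPf -> /negPf -> /negPf -> /negPf ->. Qed.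

Lemma slot_in_ins_neq j p s : (0 < j)%N -> (0 < p)%N -> j != p ->
  sorted (@step _) s -> slot_in j (ins p s) = slot_in j s.
Proof.
move=> j_gt0 p_gt0 jp ss; rewrite /slot_in.
set B := filter (bef p) s; set F := filter (fre p) s; set L := filter (aft p) s.
have hB : all (bef p) B := filter_all _ _.
have hF : all (fre p) F := filter_all _ _.
have hL : all (aft p) L := filter_all _ _.
have eS : s = B ++ F ++ L := split_level p ss.
rewrite /ins -/B -/F -/L; set y := head _ _; rewrite [in RHS]eS.
have py : fre p y.
  by rewrite /y; case: (F) hF => [_|? ? /andP[]]; first exact: fre_slot_part.
have Fy : F = nseq (size F) y.
  have : sorted (@step _) (F ++ L) by move: ss; rewrite eS => /cat_sorted2[].
  rewrite /y; case: (F) hF => //= f F' /andP[pf] {y py}.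
  elim: F' => //= f' F' IHF /andP[pf' hF'] /andP[ff' h].
  rewrite (fre_step_eq pf pf' ff') in IHF *; congr (_ :: _).
  by apply: IHF.
have y1 : y.1 = p by case/andP: py => /eqP.
case: (ltngtP j p) jp => // [jp|pj] _.
  have yb : bef j y by rewrite /bef y1 jp.
  have ya : aft j y = false by rewrite /aft y1; lia.
  have Fb : filter (bef j) F = F by apply/all_filterP; rewrite Fy all_nseq yb orbT.
  rewrite !filter_cat /= yb ya !filter_cat Fb.
  case: (filter (bef j) L) => [|w L']; last by rewrite !last_cat /= !last_cat.
  rewrite !cats0 !last_cat; case: (F) => //=.
  have : last (far j) (filter (bef j) B) \in far j :: B.
    by have := mem_last (far j) (filter (bef j) B); rewrite !inE mem_filter;
      case: eqP => //= _ /andP[].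
  set x := last _ _ => xB.
  have hx : (x == far j) || bef p x.
    by move: xB; rewrite inE => /orP[-> //|/(allP hB) ->]; rewrite orbT.
  apply: slot_far_left; rewrite ?y1; case/andP: py => _ /eqP.
  - by rewrite gtn_eqF.
  - by move=> ->; rewrite ltnn andbF.
  - by case/orP: hx => [/eqP ->|]; rewrite /bef /=; lia.
  - by case/orP: hx => [/eqP ->|]; rewrite /bef /=; lia.
have yb : bef j y = false by rewrite /bef y1; lia.
have ya : aft j y by rewrite /aft y1 pj.
have Fa : filter (aft j) F = F by apply/all_filterP; rewrite Fy all_nseq ya orbT.
rewrite !filter_cat /= yb ya !filter_cat Fa.
case: (filter (aft j) B) => [|w B'] //=.
move: (y1) (py) Fy; case: (F) => [|f F'] /=; last by move=> _ _ [->].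
move=> _ /andP[_ /eqP yk] _.
have : head ground (filter (aft j) L) \in ground :: L.
  case E: (filter (aft j) L) => [|w L'] /=; first exact: mem_head.
  have : w \in filter (aft j) L by rewrite E mem_head.
  by rewrite mem_filter inE => /andP[_ ->]; rewrite orbT.
set x := head _ _ => xL.
have hx : (x == ground) || aft p x.
  by move: xL; rewrite inE => /orP[-> //|/(allP hL) ->]; rewrite orbT.
apply: slot_far_right; rewrite ?y1 ?yk.
- by rewrite ltn_eqF.
- by rewrite ltnn andbF.
- by case/orP: hx => [/eqP ->|]; rewrite /aft /=; lia.
- by case/orP: hx => [/eqP ->|]; rewrite /aft /=; lia.
Qed.

Lemma bad_ins_neq j p s : (0 < j)%N -> (0 < p)%N -> j != p -> inP s ->
  bad j (ins p s) = bad j s.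
Proof.
move=> j_gt0 p_gt0 jp /inP_sorted ss; rewrite /bad slot_in_ins_neq //.
suff -> : filter (fre j) (ins p s) = filter (fre j) s by [].
rewrite [in RHS](split_level p ss) /ins !filter_cat /= !filter_cat.
rewrite ifN // /fre; set y := head _ _.
suff -> : y.1 = p by rewrite eq_sym (negPf jp).
rewrite /y; have := filter_all (fre p) s.
by case: (filter _ _) => //= f F /andP[/andP[/eqP]].
Qed.

Lemma head_ins p s : fre p (head (slot_part p s) (filter (fre p) s)).
Proof.
have := filter_all (fre p) s; case: (filter _ _) => [|y F] /=.
  by rewrite fre_slot_part.
by case/andP.
Qed.

Lemma weight_ins p s : inP s -> weightP (ins p s) = (weightP s + p)%N.
Proof.
move=> /inP_sorted ss; rewrite /weightP /ins [in RHS](split_level p ss).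
rewrite !big_cat /= big_cons big_cat /=.
by have /andP[/eqP-> _] := head_ins p s; lia.
Qed.

Section Peel.
Variables (A : comNzRingType) (a b : nat -> A).
Hypothesis abK : forall i, (i < n.+1)%N -> a i * b i = 1.

Lemma smono_ins p s : inP s -> smono a b (ins p s) = smono a b s.
Proof.
move=> /inP_sorted ss; rewrite /smono /ins [in RHS](split_level p ss).
rewrite !big_cat /= big_cons big_cat /=; congr (_ * _).
have /andP[_ /eqP e] := head_ins p s.
by rewrite /cweight e abK // mul1r.
Qed.

Definition peeled k s := inP s && all (fun j => ~~ bad j s) (iota 1 k).

Definition psum k m : A :=
  \sum_(s <- plist n.+1 m | peeled k s && (weightP s == m)) smono a b s.

Lemma peeledS k s : peeled k.+1 s = peeled k s && ~~ bad k.+1 s.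
Proof. by rewrite /peeled -[in iota _ _](addn1 k) iotaD all_cat /= andbT andbA add1n. Qed.

Lemma peeled_ins k s : inP s -> peeled k (ins k.+1 s) = peeled k s.
Proof.
move=> sP; rewrite /peeled inP_ins // sP /=; apply: eq_in_all => j.
by rewrite mem_iota => jk; rewrite bad_ins_neq //; lia.
Qed.

Lemma psumS k m :
  psum k m = psum k.+1 m + (if (k < m)%N then psum k (m - k.+1) else 0).
Proof.
rewrite /psum (bigID (bad k.+1)) /= addrC; congr (_ + _).
  by apply: eq_bigl => s; rewrite peeledS andbAC.
have del_spec s : peeled k s -> bad k.+1 s ->
    [/\ peeled k (del k.+1 s), weightP s = (weightP (del k.+1 s) + k.+1)%N,
        smono a b (del k.+1 s) = smono a b s & ins k.+1 (del k.+1 s) = s].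
  move=> sQ sb; have sP : inP s by case/andP: sQ.
  have dP : inP (del k.+1 s) by apply: inP_del.
  by rewrite -(peeled_ins k dP) -(weight_ins k.+1 dP) -(smono_ins k.+1 dP) ins_del.
case: ifP => [km|/negbT km]; last first.
  rewrite big_pred0 // => s; apply/negbTE/negP => /andP[/andP[sQ /eqP sm] sb].
  by have [_ e _ _] := del_spec s sQ sb; lia.
apply: (@big_bij_seq _ _ _ _ _ _ _ _ _ _ _ (del k.+1) (ins k.+1)).
- exact: plist_uniq.
- exact: plist_uniq.
- move=> s _ /andP[/andP[sQ /eqP sm] sb].
  have [dQ e -> ->] := del_spec s sQ sb; rewrite dQ /=.
  have dm : weightP (del k.+1 s) = (m - k.+1)%N by lia.
  split=> //; last exact/eqP.
  by apply: mem_plist_weight dm; case/andP: dQ.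
- move=> s _ /andP[sQ /eqP sm]; have sP : inP s by case/andP: sQ.
  have im : weightP (ins k.+1 s) = m by rewrite weight_ins // sm subnK.
  split; last exact: del_ins.
    by apply: mem_plist_weight im; apply: inP_ins.
  by rewrite peeled_ins // sQ im eqxx bad_ins.
Qed.

Lemma psum_poly M k :
  eqX M (qfact 'X k * \poly_(m < M) psum 0 m) (\poly_(m < M) psum k m).
Proof.
elim: k => [|k IHk]; first by rewrite /qfact big_ord0 mul1r; apply: eqX_refl.
rewrite qfactS mulrAC.
apply: eqX_trans; first exact: (eqX_mul IHk (@eqX_refl _ M _)).
move=> m mM; rewrite mulrBr mulr1 coefB coefMXn !coef_poly mM (psumS k m).
case: (leqP k.+1 m) => km; last by rewrite subr0 addr0.
by rewrite (leq_ltn_trans (leq_subr _ _) mM) addrK.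
Qed.

End Peel.

Lemma has_pattern2P (P : cpart n.+1 -> cpart n.+1 -> bool) s :
  reflect (exists B x y L, s = B ++ x :: y :: L /\ P x y)
  (has_pattern2 P s).
Proof.
rewrite /has_pattern2; elim: s => [|x s IHs] /=.
  by right=> -[[|? ?] [? [? [? []]]]].
case: s IHs => [|y s] /= IHs.
  by right=> -[[|? [|? ?]] [? [? [? []]]]].
apply: (iffP orP) => [[Pxy|/IHs[B [x' [y' [L [-> PP]]]]]]|].
- by exists [::], x, y, s.
- by exists (x :: B), x', y', L.
case=> -[|x0 B] [x' [y' [L [/= e PP]]]].
  by left; move: e PP => [-> -> _].
by right; case: e => _ e; apply/IHs; exists B, x', y', L.
Qed.

Lemma has_pattern3P (P : cpart n.+1 -> cpart n.+1 -> cpart n.+1 -> bool) s :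
  reflect (exists B x y z L, s = B ++ x :: y :: z :: L /\ P x y z)
  (has_pattern3 P s).
Proof.
rewrite /has_pattern3; elim: s => [|x s IHs] /=.
  by right=> -[[|? ?] [? [? [? [? []]]]]].
case: s IHs => [|y s] /= IHs.
  by right=> -[[|? [|? ?]] [? [? [? [? []]]]]].
case: s IHs => [|z s] /= IHs.
  by right=> -[[|? [|? [|? ?]]] [? [? [? [? []]]]]].
apply: (iffP orP) => [[Pxy|/IHs[B [x' [y' [z' [L [-> PP]]]]]]]|].
- by exists [::], x, y, z, s.
- by exists (x :: B), x', y', z', L.
case=> -[|x0 B] [x' [y' [z' [L [/= e PP]]]]].
  by left; move: e PP => [-> -> -> _].
by right; case: e => _ e; apply/IHs; exists B, x', y', z', L.
Qed.

Lemma bad_single p B y L : (0 < p)%N -> sorted (@step _) (B ++ y :: L) ->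
    fre p y -> bef p (last (far p) B) -> aft p (head ground L) ->
    (y.2.1 : nat)%:Z = slot p (last (far p) B) (head ground L) ->
  bad p (B ++ y :: L).
Proof.
move=> p_gt0 ss py pB pL ey.
have := sorted_by_rank p ss; rewrite pairwise_cat => /and3P[/allrelP _ rB /= /andP[ry rL]].
have hB : all (bef p) B.
  move: pB rB; case/lastP: B {ss ey} => [|B x] //; rewrite last_rcons => px.
  rewrite pairwise_rcons all_rcons px => /andP[/allP h _].
  apply/allP => w /h /=; rewrite /by_rank /= befE.
  by move: px; rewrite befE => /eqP ->; rewrite leqn0.
have hL : all (aft p) L.
  move: pL rL; case: L {ss ey ry} => [|x L] //= px /andP[/allP h _].
  rewrite px; apply/allP => w /h /=; rewrite aftE.
  move: px; rewrite aftE => /eqP -> w2; rewrite eqn_leq w2 andbT.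
  by rewrite /rank; do 2?case: ifP.
have hF : all (fre p) [:: y] by rewrite /= py.
have [eB eF eL] := filter_split hB hF hL.
by rewrite /bad /slot_in -cat1s eF eB eL /= ey eqxx.
Qed.

Lemma ndelta_level_left x y p : x.1 = p -> (x.2.1 < x.2.2)%N -> fre p y ->
  step x y -> (x.2.1 < y.2.1 <= x.2.2)%N.
Proof.
move=> x1 kl /andP[/eqP y1 /eqP ey]; rewrite /step ey x1 y1.
by rewrite ndelta_freer ?ltn_eqF //; lia.
Qed.

Lemma ndelta_level_right y z p : z.1 = p -> (z.2.2 < z.2.1)%N -> fre p y ->
  step y z -> (z.2.2 < y.2.1 <= z.2.1)%N.
Proof.
move=> z1 kl /andP[/eqP y1 /eqP ey]; rewrite /step ey z1 y1.
by rewrite ndelta_freel ?gtn_eqF //; lia.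
Qed.

Lemma bef_neq p x : bef p x -> x.1 != p -> (p < x.1)%N.
Proof. by rewrite /bef => /orP[//|/andP[/eqP -> _]]; rewrite eqxx. Qed.

Lemma aft_neq p z : aft p z -> z.1 != p -> (z.1 < p)%N.
Proof. by rewrite /aft => /orP[//|/andP[/eqP -> _]]; rewrite eqxx. Qed.

Lemma bad_zero p s : (0 < p)%N -> inP s ->
  has (fun x => fre p x && ((x.2.1 : nat) == 0%N)) s -> bad p s.
Proof.
move=> p_gt0 /inP_sorted ss /hasP[y ys /andP[py /eqP y0]].
have : y \in filter (fre p) s by rewrite mem_filter py.
rewrite /bad; have e := split_level p ss.
case E: (filter (fre p) s) e => [|f F] // e; case: F E e => //= E e.
rewrite inE => /eqP yf; rewrite -yf in e; rewrite -yf y0.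
move: ss; rewrite {1}e (sorted_slot _ _ p_gt0 py) => /and4P[_ xy yz _].
rewrite /slot_in.
set x := last _ _ in xy *; set z := head _ _ in yz *.
have px : bef p x by apply: all_bef_last; apply: filter_all.
have pz : aft p z by apply: all_aft_head => //; apply: filter_all.
rewrite /slot; case: (eqVneq x.1 p) => [xp|_].
  have kl : (x.2.1 < x.2.2)%N by move: px; rewrite /bef xp ltnn eqxx.
  by have := ndelta_level_left xp kl py xy; rewrite y0.
case: (eqVneq z.1 p) => // zp.
have kl : (z.2.2 < z.2.1)%N by move: pz; rewrite /aft zp ltnn eqxx.
by have := ndelta_level_right zp kl py yz; rewrite y0.
Qed.

Lemma free_atP k (c : colour n.+1) : free_at k c ->
  (c.1 == c.2 :> nat) /\ (c.1 : nat)%:Z = k.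
Proof. by case/andP=> /eqP -> /eqP. Qed.

Lemma bad_triple B x y z L : (0 < y.1)%N -> sorted (@step _) (B ++ x :: y :: z :: L) ->
    fre y.1 y -> bef y.1 x -> aft y.1 z -> (y.2.1 : nat)%:Z = slot y.1 x z ->
  bad y.1 (B ++ x :: y :: z :: L).
Proof.
by rewrite -cat_rcons => ? ? ? ? ? ?; apply: bad_single; rewrite ?last_rcons.
Qed.

Lemma inC_of_good s : inP s -> (forall y, y \in s -> ~~ bad y.1 s) ->
  inC delta gamma s.
Proof.
move=> sP good; have ss := inP_sorted sP.
have s_gt0 y : y \in s -> (0 < y.1)%N by move: y; apply/allP; case/andP: sP.
have freP (y : cpart n.+1) : y.2.1 == y.2.2 :> nat -> fre y.1 y.
  by rewrite /fre eqxx.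
have triple (P : cpart n.+1 -> cpart n.+1 -> cpart n.+1 -> bool) :
    (forall x y z, P x y z -> [/\ y.2.1 == y.2.2 :> nat, bef y.1 x, aft y.1 z
        & (y.2.1 : nat)%:Z = slot y.1 x z]) -> ~~ has_pattern3 P s.
  move=> PP; apply/has_pattern3P => -[B [x [y [z [L [es /PP[ey px pz e]]]]]]].
  have ys : y \in s by rewrite es mem_cat !inE eqxx !orbT.
  have := good y ys; rewrite es bad_triple -?es ?s_gt0 //; exact: freP.
rewrite /inC sP /=; do !(apply/andP; split).
- apply/hasPn => y ys; apply/negP => /free_atP[ey y0].
  have := good y ys; rewrite bad_zero ?s_gt0 //; apply/hasP; exists y => //.
  by rewrite freP //=; case: y0 => ->.
- apply/has_pattern2P => -[B [x [y [L [es /and3P[/eqP ex _ /eqP exy]]]]]].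
  have xs : x \in s by rewrite es mem_cat !inE eqxx !orbT.
  have : (1 < size (filter (fre x.1) s))%N.
    rewrite es -exy filter_cat size_cat /= freP /= ?ex //; lia.
  by have := good x xs; rewrite /bad; case: (filter _ _) => [|f [|f' F]].
- apply: triple => x y z /and4P[/eqP xy /eqP yz cr /free_atP[ey ->]].
  move: cr; rewrite /cross gtn_max !ltn_min => /andP[/andP[_ kl] /andP[lk _]].
  by rewrite /bef /aft /slot xy -yz !eqxx kl lk !orbT.
- apply: triple => x y z /andP[/and3P[lk /eqP yz /free_atP[ey ->]] yx].
  have yx2 : (y.1.+1 < x.1)%N by rewrite addn2 in yx.
  have yx1 := ltnW yx2.
  by rewrite /bef /aft /slot -yz eqxx lk orbT yx1 (gtn_eqF yx1) (gtn_eqF yx2).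
- case: s ss s_gt0 good {sP triple} => // y [|z L] // ss s_gt0 good.
  apply/negP => /and3P[lk /eqP yz /free_atP[ey e]].
  have ys : y \in [:: y, z & L] by rewrite mem_head.
  have := good y ys; rewrite (@bad_single y.1 [::] y) ?s_gt0 ?freP ?bef_far //=.
    by rewrite /aft -yz eqxx lk orbT.
  have n1 : (y.1.+2 == y.1) = false by rewrite gtn_eqF // ltnW.
  by rewrite /slot /= -yz eqxx e n1 ltnn andbF.
- apply: triple => x y z /and3P[/and3P[lk /eqP yz /free_atP[ey ->]] /eqP xy kl].
  rewrite /bef /aft /slot -yz xy eqxx lk orbT ltnSn /= (gtn_eqF (ltnSn _)).
  by rewrite ltnNge kl andbF.
- apply: triple => x y z /andP[lk /and5P[/eqP yz /eqP xy lk1 _ /free_atP[ey ->]]].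
  by rewrite /bef /aft /slot -yz xy !eqxx lk orbT ltnSn /= (gtn_eqF (ltnSn _)) lk1.
- apply: triple => x y z /andP[/and3P[kl /eqP xy /free_atP[ey ->]] yz].
  have yz2 : (z.1.+1 < y.1)%N by rewrite addn2 in yz.
  have yz1 := ltnW yz2.
  by rewrite /bef /aft /slot xy eqxx kl orbT yz1 (ltn_eqF yz1) (gtn_eqF yz2).
- rewrite /pat_d1_oo; case E: (rev s) => [|y [|x r]] //.
  have es : s = rcons (rev r) x ++ [:: y].
    by rewrite cats1 -(revK s) E !rev_cons.
  apply/negP => /and3P[kl /eqP xy /free_atP[ey e]].
  have ys : y \in s by rewrite es mem_cat mem_head orbT.
  have := good y ys; rewrite es bad_single -?es ?s_gt0 ?freP ?last_rcons ?aft_ground ?s_gt0 //.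
    by rewrite /bef -xy eqxx kl orbT.
  by rewrite /slot xy eqxx /= e eq_sym (gtn_eqF (s_gt0 _ ys)) ltnn andbF.
- apply: triple => x y z /and3P[/and3P[kl /eqP xy /free_atP[ey ->]] /eqP yz lk].
  rewrite /bef /aft /slot xy yz eqxx kl orbT ltnSn /= (ltn_eqF (ltnSn _)).
  by rewrite ltnNge lk.
- apply: triple => x y z /andP[kl /and5P[/eqP xy /eqP yz kl2 _ /free_atP[ey ->]]].
  by rewrite /bef /aft /slot xy yz !eqxx kl orbT ltnSn /= (ltn_eqF (ltnSn _)) kl2.
Qed.

Lemma bad_cases p s : (0 < p)%N -> inP s -> bad p s ->
  (exists B y L, [/\ s = B ++ y :: y :: L & fre p y]) \/
  (exists B y L, [/\ s = B ++ y :: L, fre p y,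
     (y.2.1 : nat)%:Z = slot p (last (far p) B) (head ground L),
     bef p (last (far p) B) /\ aft p (head ground L) &
     step (last (far p) B) y /\ step y (head ground L)]).
Proof.
move=> p_gt0 /inP_sorted ss; rewrite /bad; have := split_level p ss.
have := filter_all (fre p) s.
case E: (filter (fre p) s) => [|y F] //= /andP[py]; case: F {E} => [|y' F] /=.
  move=> _ es /eqP ey; right; exists (filter (bef p) s), y, (filter (aft p) s).
  have := ss; rewrite {1}es (sorted_slot _ _ p_gt0 py) => /and4P[_ s1 s2 _].
  split=> //; split; first by apply: all_bef_last; apply: filter_all.
  by apply: all_aft_head => //; apply: filter_all.
case/andP=> py' _ es _; left; exists (filter (bef p) s), y, (F ++ filter (aft p) s).
have := ss; rewrite {1}es (sorted_cons3 p) /= => /and3P[_ _ /andP[yy' _]].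
by rewrite -(fre_step_eq py py' yy') in es.
Qed.

Lemma free_at_fre p (y : cpart n.+1) k : fre p y -> (y.2.1 : nat)%:Z = k ->
  free_at k y.2.
Proof.
by case/andP=> _ /eqP e1 e2; rewrite /free_at e2 eqxx andbT /is_free -val_eqE /= e1.
Qed.

Lemma good_of_inC p s : (0 < p)%N -> inC delta gamma s -> ~~ bad p s.
Proof.
move=> p_gt0 sC; apply/negP => sb.
have sP : inP s by case/andP: sC.
case/andP: sC => _ /andP[/hasPn C0 /andP[/negP Ca /andP[/negP Cb /andP[/negP Cc1
  /andP[/negP Cc1o /andP[/negP Cc2 /andP[/negP Cc3 /andP[/negP Cd1 /andP[/negP Cd1o
  /andP[/negP Cd2 /negP Cd3]]]]]]]]]].
case: (bad_cases p_gt0 sP sb) => [[B [y [L [es py]]]]|].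
  have ys : y \in s by rewrite es mem_cat mem_head orbT.
  apply: Ca; apply/has_pattern2P; exists B, y, y, L; split=> //.
  rewrite /pat_a eqxx andbT; case/andP: (py) => _ /eqP e1.
  rewrite /is_free -val_eqE /= e1 eqxx /= -e1 lt0n; apply/eqP => y0.
  by have := C0 y ys; rewrite (free_at_fre py) ?y0.
case=> B [y [L [es py]]]; set x := last _ _; set z := head _ _ => ey [px pz] [xy yz].
have ys : y \in s by rewrite es mem_cat mem_head orbT.
have y1 : y.1 = p by case/andP: py => /eqP.
have xB : (x.2.2 < x.2.1)%N \/ (x.2.1 < x.2.2)%N -> exists B', B = rcons B' x.
  rewrite /x; case: (lastP B) => [|B' x'] /=; first by case.
  by rewrite last_rcons; exists B'.
have zL : z.1 != 0%N \/ (z.2.1 < z.2.2)%N -> exists L', L = z :: L'.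
  by rewrite /z; case: (L) => [|z' L'] /= => [[]//|_]; exists L'.
have triple B' L' : B = rcons B' x -> L = z :: L' -> s = B' ++ x :: y :: z :: L'.
  by move=> eB eL; rewrite es eB eL cat_rcons.
have yfree := free_at_fre py ey.
move: ey yfree; rewrite /slot; case: (eqVneq x.1 p) => [xp|xNp].
  have kl : (x.2.1 < x.2.2)%N by move: px; rewrite /bef xp ltnn eqxx.
  have [B' eB] : exists B', B = rcons B' x by apply: xB; right.
  have /andP[ki il] := ndelta_level_left xp kl py xy.
  case: (eqVneq z.1 p) => [zp ey yf|zNp].
    have lk : (z.2.2 < z.2.1)%N by move: pz; rewrite /aft zp ltnn eqxx.
    have /andP[li ik] := ndelta_level_right zp lk py yz.
    have [L' eL] : exists L', L = z :: L' by apply: zL; left; rewrite zp -lt0n.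
    apply: Cb; apply/has_pattern3P; exists B', x, y, z, L'; split; first exact: triple.
    rewrite /pat_b xp y1 zp eqxx /= yf andbT /cross.
    by rewrite gtn_max !ltn_min (leq_trans ki ik) kl lk (leq_trans li il).
  have z_lt := aft_neq pz zNp.
  case: ifP => [/andP[/eqP zp kl2] ey yf|hz ey yf].
    have [L' eL] : exists L', L = z :: L' by apply: zL; right.
    apply: Cd3; apply/has_pattern3P; exists B', x, y, z, L'; split; first exact: triple.
    rewrite /pat_d3 kl xp y1 zp eqxx kl2 yf /= andbT.
    apply/set0Pn; exists y.2.1; rewrite ioc_diffP ki il /=.
    move: yz; rewrite /step y1 zp; case/andP: py => _ /eqP <-.
    rewrite ndelta_freel ?ltn_eqF // -[z.1.+1]addn1 leq_add2l.
    by case: (z.2.1 < _)%N; case: (_ <= z.2.2)%N.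
  case: (posnP (size L)) => [/size0nil L0|L_gt0].
    apply: Cd1o; rewrite /pat_d1_oo es L0 eB cats1 rev_rcons rev_rcons.
    by rewrite /head_d kl xp y1 eqxx.
  have [L' eL] : exists L', L = z :: L'.
    by rewrite /z; case: (L) L_gt0 => //= z' L'; exists L'.
  have [zp|zp] := eqVneq p z.1.+1.
    apply: Cd2; apply/has_pattern3P; exists B', x, y, z, L'; split; first exact: triple.
    rewrite /pat_d2 /head_d kl xp y1 yf -zp !eqxx /= leqNgt.
    by move: hz; rewrite zp eqxx /= => ->.
  apply: Cd1; apply/has_pattern3P; exists B', x, y, z, L'; split; first exact: triple.
  by rewrite /pat_d1 /head_d kl xp y1 yf eqxx /= addn2 ltn_neqAle eq_sym zp.
have x_gt := bef_neq px xNp.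
case: (eqVneq z.1 p) => [zp|zNp ey yf]; last by have := C0 y ys; rewrite yf.
have lk : (z.2.2 < z.2.1)%N by move: pz; rewrite /aft zp ltnn eqxx.
have [L' eL] : exists L', L = z :: L' by apply: zL; left; rewrite zp -lt0n.
have /andP[li ik] := ndelta_level_right zp lk py yz.
case: ifP => [/andP[/eqP xp lk1] ey yf|hx ey yf].
  have [B' eB] : exists B', B = rcons B' x by apply: xB; left.
  apply: Cc3; apply/has_pattern3P; exists B', x, y, z, L'; split; first exact: triple.
  rewrite /pat_c3 lk zp y1 xp !eqxx lk1 yf /= andbT.
  apply/set0Pn; exists y.2.1; rewrite ioc_diffP li ik /=.
  move: xy; rewrite /step y1 xp; case/andP: py => _ /eqP <-.
  rewrite ndelta_freer ?gtn_eqF // -[p.+1]addn1 leq_add2l.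
  by case: (_ <= x.2.1)%N; case: (x.2.2 < _)%N.
case: (posnP (size B)) => [/size0nil B0|B_gt0].
  apply: Cc1o; rewrite es B0 eL /= /tail_c.
  by rewrite lk zp y1 eqxx.
have [B' eB] : exists B', B = rcons B' x.
  by rewrite /x; case: (lastP B) B_gt0 => // B' x' _; exists B'; rewrite last_rcons.
have [xp|xp] := eqVneq x.1 p.+1.
  apply: Cc2; apply/has_pattern3P; exists B', x, y, z, L'; split; first exact: triple.
  rewrite /pat_c2 /tail_c lk zp y1 yf xp !eqxx /= leqNgt.
  by move: hx; rewrite xp eqxx /= => ->.
apply: Cc1; apply/has_pattern3P; exists B', x, y, z, L'; split; first exact: triple.
by rewrite /pat_c1 /tail_c lk zp y1 yf eqxx /= addn2 ltn_neqAle eq_sym xp.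
Qed.

Lemma inC_peeled k s : (weightP s <= k)%N -> inC delta gamma s = peeled k s.
Proof.
move=> sk; apply/idP/andP => [sC|[sP /allP good]].
  split; first by case/andP: sC.
  by apply/allP => j; rewrite mem_iota => /andP[j_gt0 _]; apply: good_of_inC.
apply: inC_of_good => // y ys; apply: good; rewrite mem_iota.
have [s_gt0 _] := andP sP; have [_ /allP le_s] := weight_bound s_gt0 erefl.
by rewrite (allP s_gt0 y ys) add1n ltnS (leq_trans (le_s y ys)).
Qed.

End Choice.
End Slots.

(** * Frobenius partitions and the constant term *)

Section GeneratingFunction.
Variable n : nat.

Lemma lmonomD (G : zmodType) (R : comNzRingType) (d e : G) :
  lmonom (d + e) = lmonom d * lmonom e :> laurent G R.
Proof. by rewrite /lmonom -{1}(mulr1 1) -lmul_term. Qed.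

Lemma apowD (i : 'I_n) k l : apow i (k + l) = apow i k * apow i l.
Proof.
rewrite /apow -lmonomD; congr lmonom; apply/ffunP => j; rewrite !ffunE.
by case: eqP; rewrite ?addr0.
Qed.

Lemma apow0 (i : 'I_n) : apow i 0 = 1.
Proof.
by rewrite /apow -[RHS]/(lmonom 0); congr lmonom; apply/ffunP => j; rewrite !ffunE if_same.
Qed.

Definition anat (k : int) (i : nat) : ringA n :=
  lmonom [ffun j : 'I_n => if j == i :> nat then k else 0].

Lemma anatE (i : 'I_n) k : anat k i = apow i k.
Proof. by congr lmonom; apply/ffunP => j; rewrite !ffunE val_eqE. Qed.

Lemma anatK (i : nat) : (i < n)%N -> anat 1 i * anat (-1) i = 1.
Proof. by move=> ni; rewrite -[i]/(val (Ordinal ni)) !anatE -apowD subrr apow0. Qed.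

Lemma apow_indicator (c : 'I_n) k : \prod_(i < n) apow i ((c == i)%:Z * k) = apow c k.
Proof.
rewrite (bigD1 c) //= eqxx mul1r big1 ?mulr1 // => i.
by rewrite eq_sym => /negPf ->; rewrite mul0r apow0.
Qed.

Lemma prod_apow_count (T : Type) (s : seq T) (f g : T -> 'I_n) :
  \prod_(i < n) apow i ((count (fun x => f x == i) s)%:Z
                        - (count (fun x => g x == i) s)%:Z) =
  \prod_(x <- s) (anat 1 (f x) * anat (-1) (g x)).
Proof.
elim: s => [|x s IHs]; first by rewrite big_nil big1 // => i _; rewrite subrr apow0.
rewrite big_cons -IHs !anatE -(apow_indicator (f x) 1) -(apow_indicator (g x) (-1)).
rewrite -!big_split /=; apply: eq_bigr => i _; rewrite -!apowD; congr (apow _ _).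
by rewrite !PoszD; ring.
Qed.

Lemma genfunE (N : nat -> ('I_n -> nat) -> ('I_n -> nat) -> nat) (m : nat)
    (T : finType) (P : pred T) (cu cv : T -> 'I_n -> nat) :
    (forall u v, N m u v = #|[set t | P t && ([forall i, cu t i == u i]
                                          && [forall i, cv t i == v i])]|) ->
    (forall t i, P t -> (cu t i <= m)%N && (cv t i <= m)%N) ->
  genfun N m = \sum_(t | P t) \prod_(i < n) apow i ((cu t i)%:Z - (cv t i)%:Z).
Proof.
move=> NE bound; rewrite /genfun (pair_big xpredT xpredT) /=.
pose good (t : T) (w : {ffun 'I_n -> 'I_m.+1} * {ffun 'I_n -> 'I_m.+1}) :=
  [forall i, cu t i == w.1 i] && [forall i, cv t i == w.2 i].
transitivity (\sum_(w : {ffun 'I_n -> 'I_m.+1} * {ffun 'I_n -> 'I_m.+1})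
   \sum_(t | P t && good t w) \prod_(i < n) apow i ((cu t i)%:Z - (cv t i)%:Z)).
  apply: eq_bigr => -[u v] _ /=; rewrite NE -sum1_card natr_sum mulr_suml.
  apply: eq_big => [t|t]; rewrite inE // => /and3P[_ /forallP uE /forallP vE].
  by rewrite mul1r; apply: eq_bigr => i _; rewrite (eqP (uE i)) (eqP (vE i)).
rewrite (exchange_big_dep P) /=; last by move=> w t _ /andP[].
apply: eq_bigr => t Pt.
pose w0 := ([ffun i => inord (cu t i)] : {ffun 'I_n -> 'I_m.+1},
            [ffun i => inord (cv t i)] : {ffun 'I_n -> 'I_m.+1}).
rewrite (big_pred1 w0) // => -[u v]; rewrite Pt /good /=.
apply/andP/eqP => [[/forallP uE /forallP vE]|[-> ->]].
  by congr (_, _); apply/ffunP => i; rewrite ffunE ?(eqP (uE i)) ?(eqP (vE i)) inord_val.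
by split; apply/forallP => i; have /andP[? ?] := bound t i Pt; rewrite ffunE inordK.
Qed.

Lemma genfun_C (delta : colour n -> int) (gamma : colour n -> colour n -> int) m :
  genfun (C_num delta gamma) m =
  \sum_(s <- plist n m | inC delta gamma s && (weightP s == m))
    smono (anat 1) (anat (-1)) s.
Proof.
pose P s := inC delta gamma s && (weightP s == m).
rewrite (@genfunE _ m _ (fun t : m.-bseq ('I_m.+1 * colour n) =>
     P (map (@cpart_of_ord n m) t))
  (fun t i => count (fun x => x.2.1 == i) (map (@cpart_of_ord n m) t))
  (fun t i => count (fun x => x.2.2 == i) (map (@cpart_of_ord n m) t))).
- rewrite -(big_bseq_list m (@cpart_of_ord n m) _ P).
  apply: eq_bigr => t _.
  exact: (prod_apow_count _ (fun x : cpart n => x.2.1) (fun x => x.2.2)).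
- by move=> u v; congr #|pred_of_set _|; apply/setP => t; rewrite !inE /C_spec andbA.
move=> t i; rewrite /P => /andP[tC tm].
have : C_spec delta gamma m (fun i => count (fun x => x.2.1 == i) (map (@cpart_of_ord n m) t))
   (fun i => count (fun x => x.2.2 == i) (map (@cpart_of_ord n m) t))
   (map (@cpart_of_ord n m) t).
  by rewrite /C_spec tC tm !andTb; apply/andP; split; apply/forallP => j.
by case/C_spec_bounded => _ _ hu hv; rewrite hu hv.
Qed.

Definition flist m : seq (seq (fcolumn n)) := bseq_list m (@fcolumn_of_ord n m).

Definition fmono (s : seq (fcolumn n)) : ringA n :=
  \prod_(x <- s) (anat 1 x.1.2 * anat (-1) x.2.2).

Lemma genfun_F m : genfun (@F_num n) m =
  \sum_(s <- flist m | frobenius s && (weightF s == m)) fmono s.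
Proof.
pose P (s : seq (fcolumn n)) := frobenius s && (weightF s == m).
rewrite (@genfunE _ m _ (fun t : m.-bseq (('I_m.+1 * 'I_n) * ('I_m.+1 * 'I_n)) =>
     P (map (@fcolumn_of_ord n m) t))
  (fun t i => count (fun x => x.2 == i) (unzip1 (map (@fcolumn_of_ord n m) t)))
  (fun t i => count (fun x => x.2 == i) (unzip2 (map (@fcolumn_of_ord n m) t)))).
- rewrite -(big_bseq_list m (@fcolumn_of_ord n m) _ P).
  apply: eq_bigr => t _.
  have := prod_apow_count (map (@fcolumn_of_ord n m) t) (fun x : fcolumn n => x.1.2)
     (fun x => x.2.2).
  rewrite -[RHS]/(fmono _) => <-; apply: eq_bigr => i _.
  by rewrite !count_map.
- by move=> u v; congr #|pred_of_set _|; apply/setP => t; rewrite !inE /F_spec andbA.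
move=> t i; rewrite /P => /andP[tC tm].
have : F_spec m
   (fun i => count (fun x => x.2 == i) (unzip1 (map (@fcolumn_of_ord n m) t)))
   (fun i => count (fun x => x.2 == i) (unzip2 (map (@fcolumn_of_ord n m) t)))
   (map (@fcolumn_of_ord n m) t).
  by rewrite /F_spec tC tm !andTb; apply/andP; split; apply/forallP => j.
by case/F_spec_bounded => _ _ hu hv; rewrite hu hv.
Qed.

End GeneratingFunction.

Section SetList.
Variables (n M : nat) (lt : rel (nat * 'I_n)).
Hypotheses (lt_irr : irreflexive lt) (lt_trans : transitive lt).
Hypothesis lt_total : forall x y, [|| lt x y, x == y | lt y x].

Let le x y := (x == y) || lt x y.

Definition cell (x : 'I_n * 'I_M) : nat * 'I_n := (nat_of_ord x.2, x.1).

Definition set_list (S : {set 'I_n * 'I_M}) : seq (nat * 'I_n) :=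
  sort le (map cell (enum S)).

Definition list_set (s : seq (nat * 'I_n)) : {set 'I_n * 'I_M} :=
  [set x | cell x \in s].

Lemma cell_inj : injective cell.
Proof. by move=> [i p] [i' p'] [/val_inj -> ->]. Qed.

Lemma set_list_perm S : perm_eq (set_list S) (map cell (enum S)).
Proof. by rewrite perm_sort. Qed.

Lemma mem_set_list S x : (cell x \in set_list S) = (x \in S).
Proof. by rewrite (perm_mem (set_list_perm S)) (mem_map cell_inj) mem_enum. Qed.

Lemma set_listK : cancel set_list list_set.
Proof. by move=> S; apply/setP => x; rewrite inE mem_set_list. Qed.

Lemma set_list_sorted S : sorted lt (set_list S).
Proof.
have u : uniq (set_list S).
  by rewrite (perm_uniq (set_list_perm S)) (map_inj_uniq cell_inj) enum_uniq.
have : sorted le (set_list S).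
  apply: sort_sorted => x y; rewrite /le.
  by case/or3P: (lt_total x y) => [-> | -> | ->]; rewrite ?orbT.
case: (set_list S) u => //= x s; elim: s x => //= y s IHs x.
case/and3P=> xys ys us /andP[+ ps]; rewrite IHs ?ys //= andbT.
by case/orP=> // /eqP xy; move: xys; rewrite xy mem_head.
Qed.

Lemma list_setK s : sorted lt s -> all (fun x => x.1 < M)%N s ->
  set_list (list_set s) = s.
Proof.
move=> ss /allP sM; apply: (irr_sorted_eq lt_trans lt_irr) => //.
  exact: set_list_sorted.
move=> [p i]; apply/idP/idP => [|ps].
  rewrite (perm_mem (set_list_perm _)) => /mapP[x].
  by rewrite mem_enum inE => xs ->.
by have := mem_set_list (list_set s) (i, Ordinal (sM _ ps)); rewrite inE => ->.
Qed.

Lemma size_set_list S : size (set_list S) = #|S|.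
Proof. by rewrite (perm_size (set_list_perm S)) size_map cardE. Qed.

Lemma big_set_list (R : Type) (idx : R) (op : Monoid.com_law idx)
    (S : {set 'I_n * 'I_M}) (F : nat * 'I_n -> R) :
  \big[op/idx]_(x <- set_list S) F x = \big[op/idx]_(x in S) F (cell x).
Proof. by rewrite (perm_big _ (set_list_perm S)) big_map big_enum. Qed.

End SetList.

Section PairSum.
Variables (A : comNzRingType) (n M : nat) (a b : nat -> A).
Implicit Types S T : {set 'I_n * 'I_M}.

Definition height S : nat := \sum_(x in S) x.2.

Definition pair_weight S T : nat := (#|S| + height S + height T)%N.

Definition pair_mono S T : A := (\prod_(x in S) a x.1) * (\prod_(x in T) b x.1).

Definition pair_sum (m : nat) : A :=
  \sum_(p : {set 'I_n * 'I_M} * {set 'I_n * 'I_M}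
        | (#|p.1| == #|p.2|) && (pair_weight p.1 p.2 == m)) pair_mono p.1 p.2.

Lemma level_prod (c : nat -> A) S :
  \prod_(x in S) level_weight c n x = (\prod_(x in S) c x.1)%:P * 'X^(height S).
Proof.
rewrite /height -prodrXr rmorph_prod -big_split; apply: eq_bigr => x _.
by rewrite /level_weight leqNgt ltn_ord addn0.
Qed.

Lemma coef_double_esym k m : (m <= k)%N ->
  (double_esym n a b M k)`_m = pair_sum m.
Proof.
move=> mk; rewrite /double_esym coef_sum /pair_sum.
rewrite [RHS](partition_big
  (fun p : {set 'I_n * 'I_M} * {set 'I_n * 'I_M} => inord #|p.1| : 'I_k.+1) xpredT) //=.
apply: eq_bigr => r _.
have -> : 'X^r * (level_esym n M a r n * level_esym n M b r n) =
    \sum_(S : {set 'I_n * 'I_M} | #|S| == r) \sum_(T : {set 'I_n * 'I_M} | #|T| == r)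
       (pair_mono S T)%:P * 'X^(r + height S + height T).
  rewrite /level_esym /esym big_distrlr /= mulr_sumr; apply: eq_bigr => S _.
  rewrite mulr_sumr; apply: eq_bigr => T _.
  by rewrite !level_prod /pair_mono polyCM !exprD; ring.
rewrite pair_big /= coef_sum big_mkcond [RHS]big_mkcond.
apply: eq_bigr => -[S T] _ /=; rewrite coefCM coefXn.
case: (eqVneq #|S| r) => [Sr|Sr] /=.
  rewrite Sr inord_val eqxx andbT eq_sym /pair_weight Sr.
  by case: eqP => //= _; rewrite eq_sym; case: eqP => _; rewrite ?mulr1 ?mulr0.
case: ifP => // /andP[/andP[_ /eqP wm] /eqP Sr'].
case/eqP: Sr; rewrite -Sr' inordK // ltnS; apply: leq_trans mk.
by rewrite -wm /pair_weight -addnA leq_addr.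
Qed.

End PairSum.

Section Pairs.
Variables (n M : nat).
Implicit Types S T : {set 'I_n * 'I_M}.

Let top_gt : rel (nat * 'I_n) := fun x y => top_lt y x.
Let bot_gt : rel (nat * 'I_n) := fun x y => bot_lt y x.

Lemma top_gt_irr : irreflexive top_gt.
Proof. by move=> x; rewrite /top_gt /top_lt; lia. Qed.

Lemma bot_gt_irr : irreflexive bot_gt.
Proof. by move=> x; rewrite /bot_gt /bot_lt; lia. Qed.

Lemma top_gt_trans : transitive top_gt.
Proof. by move=> y x z; rewrite /top_gt /top_lt; lia. Qed.

Lemma bot_gt_trans : transitive bot_gt.
Proof. by move=> y x z; rewrite /bot_gt /bot_lt; lia. Qed.

Lemma top_gt_total x y : [|| top_gt x y, x == y | top_gt y x].
Proof.
by case: x y => [p i] [q j]; rewrite /top_gt /top_lt xpair_eqE -val_eqE /=; lia.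
Qed.

Lemma bot_gt_total x y : [|| bot_gt x y, x == y | bot_gt y x].
Proof.
by case: x y => [p i] [q j]; rewrite /bot_gt /bot_lt xpair_eqE -val_eqE /=; lia.
Qed.

Definition columns S T : seq (fcolumn n) :=
  zip (set_list top_gt S) (set_list bot_gt T).

Definition top_set (s : seq (fcolumn n)) : {set 'I_n * 'I_M} := list_set M (unzip1 s).
Definition bot_set (s : seq (fcolumn n)) : {set 'I_n * 'I_M} := list_set M (unzip2 s).

Lemma unzip1_columns S T : #|S| = #|T| -> unzip1 (columns S T) = set_list top_gt S.
Proof. by move=> e; rewrite unzip1_zip // !size_set_list e. Qed.

Lemma unzip2_columns S T : #|S| = #|T| -> unzip2 (columns S T) = set_list bot_gt T.
Proof. by move=> e; rewrite unzip2_zip // !size_set_list e. Qed.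

Lemma weight_columns S T : #|S| = #|T| -> weightF (columns S T) = pair_weight S T.
Proof.
move=> e; rewrite /weightF unzip1_columns // unzip2_columns // !big_set_list.
by rewrite size_zip !size_set_list /pair_weight e minnn.
Qed.

Lemma fmonoE (s : seq (fcolumn n)) : fmono s =
  (\prod_(x <- unzip1 s) anat n 1 x.2) * (\prod_(x <- unzip2 s) anat n (-1) x.2).
Proof. by rewrite !big_map -big_split. Qed.

Lemma fmono_columns S T : #|S| = #|T| ->
  fmono (columns S T) = pair_mono (anat n 1) (anat n (-1)) S T.
Proof.
move=> e; rewrite fmonoE (unzip1_columns e) (unzip2_columns e).
by congr (_ * _); exact: big_set_list.
Qed.

Lemma frobenius_columns S T : #|S| = #|T| -> frobenius (columns S T).
Proof.
move=> e; rewrite /frobenius unzip1_columns // unzip2_columns //.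
rewrite (set_list_sorted top_gt_total) ?(set_list_sorted bot_gt_total) //.
Qed.

Lemma frobenius_bounded m (s : seq (fcolumn n)) : frobenius s -> weightF s = m ->
  (size s <= m)%N /\ all (fun x => (x.1.1 <= m) && (x.2.1 <= m))%N s.
Proof.
move=> sF sm.
have : F_spec m (fun i => count (fun x => x.2 == i) (unzip1 s))
   (fun i => count (fun x => x.2 == i) (unzip2 s)) s.
  by rewrite /F_spec sF sm eqxx !andTb; apply/andP; split; apply/forallP.
by case/F_spec_bounded.
Qed.

Lemma mem_flist m (s : seq (fcolumn n)) : frobenius s -> weightF s = m ->
  s \in flist n m.
Proof.
move=> sF sm; have [size_s /allP le_s] := frobenius_bounded sF sm.
apply: mem_bseq_list => // -[[p i] [q j]] /le_s /= /andP[pm qm].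
by apply/codomP; exists ((inord p, i), (inord q, j)); rewrite /fcolumn_of_ord /= !inordK.
Qed.

Lemma genfun_F_pairs m : (m < M)%N -> genfun (@F_num n) m =
  pair_sum n M (anat n 1) (anat n (-1)) m.
Proof.
move=> mM; rewrite genfun_F /pair_sum; symmetry.
apply: (@big_bij_seq _ _ _ _ _ _ _ _ _ _ _
  (fun p => columns p.1 p.2) (fun s => (top_set s, bot_set s))).
- exact: index_enum_uniq.
- by apply: bseq_list_uniq => -[[p i] [q j]] [[p' i'] [q' j']] [/val_inj -> -> /val_inj -> ->].
- move=> [S T] _ /= /andP[/eqP e /eqP wm].
  have cm : weightF (columns S T) = m by rewrite weight_columns.
  split; first by apply: mem_flist cm; apply: frobenius_columns.
  + by rewrite frobenius_columns // cm eqxx.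
  + exact: fmono_columns.
  + by rewrite /top_set /bot_set unzip1_columns // unzip2_columns // !set_listK.
move=> s _ /andP[sF /eqP sm].
have [_ /allP le_s] := frobenius_bounded sF sm; have /andP[s1 s2] := sF.
have K1 : set_list top_gt (top_set s) = unzip1 s.
  apply: (list_setK top_gt_irr top_gt_trans top_gt_total) => //.
  rewrite all_map; apply/allP => x /le_s /= /andP[xm _].
  exact: leq_ltn_trans xm mM.
have K2 : set_list bot_gt (bot_set s) = unzip2 s.
  apply: (list_setK bot_gt_irr bot_gt_trans bot_gt_total) => //.
  rewrite all_map; apply/allP => x /le_s /= /andP[_ xm].
  exact: leq_ltn_trans xm mM.
have cK : columns (top_set s) (bot_set s) = s by rewrite /columns K1 K2 zip_unzip.
have e : #|top_set s| = #|bot_set s|.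
  by rewrite -(size_set_list top_gt) -(size_set_list bot_gt) K1 K2 !size_map.
by split; rewrite ?mem_index_enum //= e eqxx -weight_columns // cK sm eqxx.
Qed.

End Pairs.

Section ConstantTerm.

Definition agree (B : nzRingType) (m : nat) (f : series B) (p : {poly B}) :=
  forall i, (i <= m)%N -> f i = p`_i.

Lemma agree_mul (B : nzRingType) m (f g : series B) (p r : {poly B}) :
  agree m f p -> agree m g r -> agree m (smul f g) (p * r).
Proof.
move=> fp gr i im; rewrite /smul coefM; apply: eq_bigr => j _.
by rewrite fp ?gr // ?(leq_trans (leq_subr _ _)) // (leq_trans (leq_ord j)).
Qed.

Lemma agree_qpoch (B : nzRingType) m N (c : {poly B}) : (m < N)%N ->
  agree m (qpoch c) (qpoch_part c N).
Proof. by move=> mN i im; rewrite (qpochE c (leq_ltn_trans im mN)). Qed.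

Lemma agree_big (B : comNzRingType) m n (f : 'I_n -> series B) (p : 'I_n -> {poly B}) :
  (forall i, agree m (f i) (p i)) ->
  agree m (\big[@smul B/@sone B]_(i < n) f i) (\prod_(i < n) p i).
Proof.
move=> fp; elim/big_rec2: _ => [i _|i g r _ gr]; first by rewrite coef1.
exact: agree_mul.
Qed.

Lemma prod_lterm (G : zmodType) (R : comNzRingType) (I : finType) (S : {set I})
    (c : I -> R) (e : I -> G) :
  \prod_(x in S) lterm (c x) (e x) =
    lterm (\prod_(x in S) c x) (\sum_(x in S) e x) :> laurent G R.
Proof.
apply: (big_rec3 (fun x y z => z = lterm y x)) => // i x y z _ ->.
by rewrite -lmul_term.
Qed.

Variable n : nat.

Lemma lcoefD (R : comNzRingType) (f g : laurent int R) :
  lcoef 0 (f + g) = lcoef 0 f + lcoef 0 g.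
Proof. exact: mcoeffD. Qed.

Lemma lcoef0 (R : comNzRingType) : lcoef 0 (0 : laurent int R) = 0.
Proof. exact: mcoeff0. Qed.

Lemma lcoef_term (R : comNzRingType) (c : R) (e : int) :
  lcoef 0 (lterm c e) = if e == 0 then c else 0.
Proof. by rewrite /lcoef mcoeffU; case: eqP. Qed.

Lemma lcoef_sum (R : comNzRingType) (I : finType) (F : I -> laurent int R) :
  lcoef 0 (\sum_i F i) = \sum_i lcoef 0 (F i).
Proof. exact: (big_morph (lcoef 0) (@lcoefD R) (lcoef0 R)). Qed.

Lemma ct_product m :
  ct (\big[@smul (ringAx n)/@sone (ringAx n)]_(i < n)
        smul (qpoch (- (axpow i 1 1)%:P * 'X))
             (qpoch (- (axpow i (-1) (-1))%:P))) m =
  pair_sum n m.+1 (anat n 1) (anat n (-1)) m.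
Proof.
pose M := m.+1.
rewrite /ct (agree_big (m := m) (p := fun i : 'I_n =>
   qpoch_part (- (axpow i 1 1)%:P * 'X) M
   * qpoch_part (- (axpow i (-1) (-1))%:P) M)) //; last first.
  by move=> i; apply: agree_mul; apply: agree_qpoch.
pose y (x : 'I_n * 'I_M) : {poly ringAx n} := (axpow x.1 1 1)%:P * 'X^(x.2.+1).
pose z (x : 'I_n * 'I_M) : {poly ringAx n} := (axpow x.1 (-1) (-1))%:P * 'X^(x.2).
have -> : \prod_(i < n) (qpoch_part (- (axpow i 1 1)%:P * 'X) M
   * qpoch_part (- (axpow i (-1) (-1))%:P) M) = \prod_x (1 + y x) * \prod_x (1 + z x).
  rewrite big_split /= /qpoch_part !pair_big /=.
  congr (_ * _); apply: eq_bigr => x _.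
    by rewrite /y exprS mulrA !mulNr opprK.
  by rewrite /z mulNr opprK.
rewrite !prod1D mulr_suml coef_sum lcoef_sum /pair_sum.
rewrite [RHS]big_mkcond -(pair_big xpredT xpredT
   (fun S T : {set 'I_n * 'I_M} => if (#|S| == #|T|) && (pair_weight S T == m)
      then pair_mono (anat n 1) (anat n (-1)) S T else 0)) /=.
apply: eq_bigr => S _; rewrite mulr_sumr coef_sum lcoef_sum.
apply: eq_bigr => T _.
rewrite /y /z !big_split /= -!rmorph_prod !prodrXr /axpow !prod_lterm.
rewrite mulrACA -polyCM -exprD coefCM coefXn.
rewrite -[lterm _ _ * lterm _ _]/(lmul _ _) lmul_term !sumr_const.
have -> : (\sum_(x in S) x.2.+1 + \sum_(x in T) x.2)%N = pair_weight S T.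
  by rewrite /pair_weight /height -sum1_card -big_split.
rewrite andbC eq_sym; case: eqP => _ /=; last by rewrite mulr0 lcoef0.
rewrite mulr1 lcoef_term mulNrn !natz subr_eq0 eqz_nat.
case: eqP => _; last by [].
by congr (_ * _); rewrite -prod_lterm; apply: eq_bigr => x _; rewrite anatE.
Qed.

End ConstantTerm.

Lemma smul_agree (B : nzRingType) m (f f' g g' : series B) :
  (forall i, (i <= m)%N -> f i = f' i) -> (forall i, (i <= m)%N -> g i = g' i) ->
  smul f g m = smul f' g' m.
Proof.
move=> ef eg; apply: eq_bigr => i _.
by rewrite ef ?eg ?leq_subr // leq_ord.
Qed.

Lemma qpochX_qfact (B : comNzRingType) N :
  qpoch_part ('X : {poly B}) N = qfact 'X N.
Proof. by apply: eq_bigr => j _; rewrite -exprS. Qed.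

Lemma genfun_C_F (n : nat) (delta : colour n.+1 -> int)
    (gamma : colour n.+1 -> colour n.+1 -> int) :
    condition1 delta -> condition2 gamma ->
  genfun (C_num delta gamma) =1 smul (qpoch 'X) (genfun (@F_num n.+1)).
Proof.
move=> hdelta hgamma m; have [M mM] : exists M, (m < M)%N by exists m.+1.
pose a := anat n.+1 1; pose b := anat n.+1 (-1).
have abK i : (i < n.+1)%N -> a i * b i = 1 by apply: anatK.
have ab0 : a 0%N * b 0%N = 1 by apply: abK.
have -> : genfun (C_num delta gamma) m =
    (\poly_(w < M) psum delta gamma a b M w)`_m.
  rewrite coef_poly mM genfun_C /psum; apply: eq_bigl => s.
  case: (eqVneq (weightP s) m) => [sm|]; last by rewrite !andbF.
  by rewrite (@inC_peeled n delta gamma M) // sm ltnW.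
rewrite -(@psum_poly n delta gamma hdelta hgamma _ a b abK M M m mM).
have eP : eqX M (\poly_(w < M) psum delta gamma a b 0 w)
    (word_sum M a b M ((0%N, (ord0, ord0)) : cpart n.+1)).
  move=> w wM; rewrite coef_poly wM coef_word_sum // ?(ltnW wM) //.
  by apply: eq_bigl => s; rewrite /peeled /= andbT.
have eW := @word_sumE _ n.+1 M a b M (0%N, (ord0, ord0)).
rewrite /= /cweight ab0 mulr1 muln0 mul1r in eW.
have eT := transfer_esym (ltn0Sn n) (leqnn M) abK.
rewrite (eqX_mul (@eqX_refl _ M (qfact 'X M)) eP mM) (eW m mM) (eT m mM).
symmetry; apply: (agree_mul (m := m)) => // i im.
  by rewrite -qpochX_qfact (agree_qpoch 'X mM).
have iM := leq_ltn_trans im mM.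
by rewrite (genfun_F_pairs n.+1 iM) (@coef_double_esym _ n.+1 M a b M i (ltnW iM)).
Qed.

Theorem theorem1p32 (n : nat) (delta : colour n -> int)
    (gamma : colour n -> colour n -> int)
    (n_gt0 : (0 < n)%N) (hdelta : condition1 delta) (hgamma : condition2 gamma) :
  genfun (C_num delta gamma) =1 smul (qpoch 'X) (genfun (@F_num n)) /\
  smul (qpoch 'X) (genfun (@F_num n)) =1
    smul (qpoch 'X)
      (ct (\big[@smul (ringAx n)/@sone (ringAx n)]_(i < n)
             smul (qpoch (- (axpow i 1 1)%:P * 'X))
                  (qpoch (- (axpow i (-1) (-1))%:P)))).
Proof.
split; last first.
  move=> m; apply: smul_agree => // i _.
  by rewrite ct_product (genfun_F_pairs n (ltnSn i)).
case: n n_gt0 delta gamma hdelta hgamma => // n _ delta gamma hdelta hgamma.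
exact: genfun_C_F.
Qed.
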